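(* Let $n,m\ge 1$ be integers, $T>0$, $L>0$, and let $F:\mathbf{C}([0,T],\mathbb{R}^m)\to\mathbf{L}_\infty([0,T],\mathbb{R}^m)$ be an operator such that for all $x\in\mathbf{C}([0,T],\mathbb{R}^m)$ $$\max_{i=1,\ldots,m}\left(\operatorname*{ess\,sup}_{t\in[0,T]}(Fx)_i(t)-\operatorname*{ess\,inf}_{t\in[0,T]}(Fx)_i(t)\right)\le L\,\max_{i=1,\ldots,m}\left(\max_{t\in[0,T]}x_i(t)-\min_{t\in[0,T]}x_i(t)\right).$$ If the periodic problem $$x^{(n)}(t)=(Fx)(t),\quad t\in[0,T],\qquad x^{(i)}(0)=x^{(i)}(T),\quad i=0,\ldots,n-1,$$ has a non-constant solution $x\in\mathbf{AC}^{n-1}([0,T],\mathbb{R}^m)$, then $$T\ge \frac{1}{(L\,K_n)^{1/n}}.$$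
   Context: The constants $K_n$, $n=1,2,\ldots$, are defined by $$K_n=\frac{(2^{n+1}-1)|B_{n+1}|}{2^{n-1}(n+1)!}\ \text{ if } n \text{ is odd},\qquad K_n=\frac{|E_n|}{4^n n!}\ \text{ if } n\text{ is even},$$ where $B_k$ are the Bernoulli numbers ($\frac{t}{e^t-1}=\sum_{k\ge0}B_k\frac{t^k}{k!}$) and $E_k$ are the Euler numbers ($\frac{1}{\cosh t}=\sum_{k\ge0}E_k\frac{t^k}{k!}$). $\mathbf{C}([0,T],\mathbb{R}^m)$ is the space of continuous functions $[0,T]\to\mathbb{R}^m$; $\mathbf{AC}^{n-1}([0,T],\mathbb{R}^m)$ is the space of functions $[0,T]\to\mathbb{R}^m$ with absolutely continuous derivatives up to order $n-1$; $\mathbf{L}_\infty([0,T],\mathbb{R}^m)$ is the space of measurable essentially bounded functions $[0,T]\to\mathbb{R}^m$. The operator $F$ is not assumed linear. Differential equations are understood to hold for almost all $t\in[0,T]$. *)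

(* Defs.v *)
From HB Require Import structures.
From mathcomp Require Import all_boot all_order all_algebra.
From mathcomp Require Import all_classical all_reals all_analysis ess_sup_inf.
Import Order.TTheory GRing.Theory Num.Theory.
Import numFieldNormedType.Exports.

Set Implicit Arguments.
Unset Strict Implicit.
Unset Printing Implicit Defensive.

Local Open Scope classical_set_scope.
Local Open Scope ring_scope.

(* f has the exponential generating expansion f(t) = \sum_k a_k t^k / k! in a
   neighbourhood of 0. The point t = 0 is excluded because t / (e^t - 1), as a
   total function on R, does not take its limit value 1 there; since the
   identity holds on a punctured neighbourhood, it still determines a. *)
Definition has_egf (R : realType) (a : nat -> R) (f : R -> R) : Prop :=
  \forall t \near 0^',
    series (fun k : nat => a k * t ^+ k / k`!%:R) @ \oo --> f t.

Definition bernoulli_numbers (R : realType) (B : nat -> R) : Prop :=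
  has_egf B (fun t => t / (expR t - 1)).

Definition cosh (R : realType) (t : R) : R := (expR t + expR (- t)) / 2.

Definition euler_numbers (R : realType) (E : nat -> R) : Prop :=
  has_egf E (fun t => (cosh t)^-1).

Definition Kconst (R : realType) (B E : nat -> R) (n : nat) : R :=
  if odd n
  then (2 ^+ n.+1 - 1) * `|B n.+1| / (2 ^+ n.-1 * (n.+1)`!%:R)
  else `|E n| / (4 ^+ n * n`!%:R).

(* The derivative of f : D -> V, with f extended arbitrarily outside D: the
   difference quotient only sees points of D, so that it is one-sided at the
   endpoints when D is a closed interval. *)
Definition diff_quot (R : realType) (V : normedModType R) (f : R -> V) (t : R)
  : R -> V := fun s => (s - t)^-1 *: (f s - f t).

Definition derivable_in (R : realType) (V : normedModType R) (D : set R)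
    (f : R -> V) (t : R) : Prop :=
  cvg (diff_quot f t @ within D t^').

Definition derive_in (R : realType) (V : normedModType R) (D : set R)
    (f : R -> V) (t : R) : V :=
  lim (diff_quot f t @ within D t^').

Definition deriven_in (R : realType) (V : normedModType R) (D : set R)
    (n : nat) (f : R -> V) : R -> V :=
  iter n (derive_in D) f.

Definition absolutely_continuous_in (R : realType) (V : normedModType R)
    (D : set R) (f : R -> V) : Prop :=
  forall e : R, 0 < e -> exists2 d : R, 0 < d &
    forall (k : nat) (a b : 'I_k -> R),
      (forall i, D (a i) /\ D (b i) /\ a i <= b i) ->
      trivIset [set: 'I_k] (fun i => `]a i, b i[%classic) ->
      \sum_(i < k) (b i - a i) < d ->
      \sum_(i < k) `|f (b i) - f (a i)| < e.

(* The space AC^k(D, V). *)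
Definition AC_space (R : realType) (V : normedModType R) (D : set R) (k : nat)
    (f : R -> V) : Prop :=
  (forall i t, (i < k)%N -> D t -> derivable_in D (deriven_in D i f) t) /\
  (forall i, (i <= k)%N -> absolutely_continuous_in D (deriven_in D i f)).

(* Lebesgue measure concentrated on [0, T]: "almost everywhere", ess_sup and
   ess_inf for this measure are those over [0, T]. *)
Definition leb (R : realType) (T : R) : {measure set (measurableTypeR R) -> \bar R} :=
  mrestr (@lebesgue_measure R) (measurable_itv `[0, T]).

Definition C_space (R : realType) (m : nat) (T : R) (x : R -> 'rV[R]_m)
  : Prop :=
  {within `[0, T], continuous x}.

Definition Linfty_space (R : realType) (m : nat) (T : R) (y : R -> 'rV[R]_m)
  : Prop :=
  forall i : 'I_m,
    measurable_fun `[0, T] (fun t => y t ord0 i) /\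
    (ess_sup (leb T) (fun t => `|y t ord0 i|%:E) < +oo)%E.

(* An operator C([0,T], R^m) -> L_oo([0,T], R^m), given on representatives:
   elements of C([0,T]) are functions on R considered up to equality on [0,T],
   elements of L_oo([0,T]) are functions on R considered up to equality almost
   everywhere on [0,T]. *)
Definition is_operator (R : realType) (m : nat) (T : R)
    (F : (R -> 'rV[R]_m) -> (R -> 'rV[R]_m)) : Prop :=
  (forall x, C_space T x -> Linfty_space T (F x)) /\
  (forall x y, C_space T x -> C_space T y -> {in `[0, T], x =1 y} ->
     \forall t \ae leb T, F x t = F y t).

(* Both maxima below range over a nonempty index set as soon as 0 < m, so that
   the default value -oo is then irrelevant. *)
Definition max_ess_osc (R : realType) (m : nat) (T : R) (y : R -> 'rV[R]_m)
  : \bar R :=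
  (\big[maxe/-oo]_(i < m) (ess_sup (leb T) (fun t => (y t ord0 i)%:E) -
                           ess_inf (leb T) (fun t => (y t ord0 i)%:E)))%E.

(* For x in C([0,T]) the supremum and the infimum are attained. *)
Definition max_osc (R : realType) (m : nat) (T : R) (x : R -> 'rV[R]_m)
  : \bar R :=
  (\big[maxe/-oo]_(i < m) (sup [set x t ord0 i | t in `[0%R, T]] -
                           inf [set x t ord0 i | t in `[0%R, T]])%R%:E)%E.

Definition periodic_solution (R : realType) (m n : nat) (T : R)
    (F : (R -> 'rV[R]_m) -> (R -> 'rV[R]_m)) (x : R -> 'rV[R]_m) : Prop :=
  [/\ AC_space `[0, T] n.-1 x,
      \forall t \ae leb T, derivable_in `[0, T] (deriven_in `[0, T] n.-1 x) t /\
                           deriven_in `[0, T] n x t = F x t &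
      forall i, (i < n)%N ->
        deriven_in `[0, T] i x 0 = deriven_in `[0, T] i x T].

(* Main.v *)
Require Import Defs.
From mathcomp Require Import all_boot all_order all_algebra.
From mathcomp Require Import all_classical all_reals all_analysis ess_sup_inf.
From mathcomp Require Import measurable_realfun ring lra.
Import Order.TTheory GRing.Theory Num.Theory.
Import numFieldNormedType.Exports.

(** Let w be the largest oscillation of a component of the solution x; it is
attained by some component X = x_j, between a maximum point t and a minimum
point s.  Let [a, A] be the essential range of (Fx)_j and M = (A - a) / 2.
The condition on F gives A - a <= L w with w > 0; inserting this in the sharp
periodic inequality w <= (A - a) K_n T^n, of Favard-Bohr type (osc_bound), and
dividing by w yields 1 <= L K_n T^n, which is the claim.

The n-th derivative is only used through slopes: X^(n-1) is absolutely
continuous with derivative in [a, A] almost everywhere, so that its chords have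
slopes in [a, A] (AC_slope_ge and AC_slope_le, which rest on AC_nondecreasing).
In this form the information passes to the T-periodic extension of X
(periodize_slope_ge), whose lower derivatives glue together thanks to the
periodicity conditions (is_derive_periodize).

Reflections and translations then centre the slopes.  If n is even, the odd
part Z of X about the midpoint of s and t takes the value w/2 at distance
|t - s| / 2.  If n is odd, let G be a primitive of X; the odd part Z of
(G(t+u) - G(s+u)) / 2 satisfies Z'(0) = w/2, and has order n + 1.  In both
cases Z is odd and periodic, its order 2k is even and the chords of Z^(2k-1)
have slopes in [-M, M]; hence all the Z^(2j) vanish at 0 and at h = T/2
(odd_part_bound).

On [0, h] such a function is compared with the polynomials e_j defined by
e_0 = 1, -e_{j+1}'' = e_j and e_{j+1}(0) = e_{j+1}(h) = 0: descending from
Z^(2k-2) to Z, the functions M e_j - Z^(2k-2j) and M e_j + Z^(2k-2j) are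
concave and vanish at both ends, so that they are nonnegative, and so are their derivatives at 0
(lidstone_comparison).  So w/2 is at most M e_k(h/2), the maximum of M e_k, if
n is even, and at most M e_k'(0) if n is odd.

Finally, e_k is explicit: its generating function is
cos(z(u - h/2)) / cos(z h/2), so that e_k(h/2) = (T/4)^(2k) sigma_k with
sigma_k the Taylor coefficients of sec, and e_k'(0) = (T/4)^(2k-1) tau_k with
tau_k those of tan.  The former are the Euler numbers up to sign and
normalization (secant_coef_rec, from cosh * sech = 1); the latter come from the
Bernoulli numbers through t tanh t = t - b(2t) + b(4t), where
b(t) = t / (e^t - 1) (bernoulli_secant). *)

Local Open Scope classical_set_scope.
Local Open Scope ring_scope.

Set Implicit Arguments.
Unset Strict Implicit.
Unset Printing Implicit Defensive.

(** * Euler and Bernoulli numbers as coefficients of sec and tan *)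

Section Jets.
Context {R : realType}.
Implicit Types (f g : R -> R) (p q : {poly R}) (a b : nat -> R).

(** Taylor expansion with an O(t^N) remainder at 0, as a relation between
functions and polynomials.  It is compatible with products and determines the
coefficients below N, which replaces Cauchy products of power series and the
identity theorem. *)
Definition jet (N : nat) f p : Prop :=
  exists C : R, \forall t \near 0^', `|f t - p.[t]| <= C * `|t| ^+ N.

Lemma jet_poly N p : jet N (horner p) p.
Proof. by exists 0; near=> t; rewrite subrr normr0 mul0r.
Unshelve. all: by end_near. Qed.

Lemma jet_near N f g p : (\forall t \near 0^', f t = g t) -> jet N f p -> jet N g p.
Proof.
move=> fg [C fp]; exists C; near=> t.
by have <- : f t = g t by [near: t; exact: fg]; near: t.
Unshelve. all: by end_near. Qed.

Lemma jetD N f g p q : jet N f p -> jet N g q -> jet N (fun t => f t + g t) (p + q).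
Proof.
move=> [C fp] [C' gq]; exists (C + C'); near=> t.
have h1 : `|f t - p.[t]| <= C * `|t| ^+ N by near: t.
have h2 : `|g t - q.[t]| <= C' * `|t| ^+ N by near: t.
rewrite hornerD mulrDl; apply: le_trans (lerD h1 h2).
have -> : f t + g t - (p.[t] + q.[t]) = (f t - p.[t]) + (g t - q.[t]) by ring.
exact: ler_normD.
Unshelve. all: by end_near. Qed.

Lemma horner_bounded p : exists K : R, \forall t \near 0^', `|p.[t]| <= K.
Proof.
have cp : (fun t => `|p.[t]|) @ (0 : R) --> `|p.[0]|.
  by apply: cvg_norm; exact: continuous_horner.
exists (`|p.[0]| + 1); apply: nbhs_dnbhs.
have /cvgrPdist_le/(_ 1 ltr01) := cp; apply: filterS => t.
by rewrite ler_distl => /andP[h _]; lra.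
Qed.

Lemma jetM N f g p q : jet N f p -> jet N g q -> jet N (fun t => f t * g t) (p * q).
Proof.
move=> [C fp] [C' gq].
have [K pK] := horner_bounded p; have [K' qK] := horner_bounded q.
exists (`|C| * `|C'| + `|C| * K' + K * `|C'|); near=> t.
have h1 : `|f t - p.[t]| <= C * `|t| ^+ N by near: t.
have h2 : `|g t - q.[t]| <= C' * `|t| ^+ N by near: t.
have h3 : `|p.[t]| <= K by near: t.
have h4 : `|q.[t]| <= K' by near: t.
have t1 : `|t| ^+ N <= 1.
  by apply: exprn_ile1 => //; near: t; exact: dnbhs0_le.
have t0 : 0 <= `|t| ^+ N by exact: exprn_ge0.
have {}h1 : `|f t - p.[t]| <= `|C| * `|t| ^+ N.
  by apply: le_trans h1 _; rewrite ler_wpM2r// ler_norm.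
have {}h2 : `|g t - q.[t]| <= `|C'| * `|t| ^+ N.
  by apply: le_trans h2 _; rewrite ler_wpM2r// ler_norm.
have {}h2' : `|g t - q.[t]| <= `|C'|.
  by apply: le_trans h2 _; rewrite ler_piMr.
have -> : f t * g t - (p * q).[t] = (f t - p.[t]) * (g t - q.[t]) +
   (f t - p.[t]) * q.[t] + p.[t] * (g t - q.[t]) by rewrite hornerM; ring.
have -> : (`|C| * `|C'| + `|C| * K' + K * `|C'|) * `|t| ^+ N =
  `|C| * `|t| ^+ N * `|C'| + `|C| * `|t| ^+ N * K' + K * (`|C'| * `|t| ^+ N) by ring.
apply: le_trans (ler_normD _ _) _; apply: lerD; last first.
  by rewrite normrM; exact: ler_pM.
by apply: le_trans (ler_normD _ _) _; rewrite !normrM; apply: lerD; exact: ler_pM.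
Unshelve. all: by end_near. Qed.

(** A polynomial that is O(t^(N+1)) vanishes at 0; dividing it by 'X leaves one
that is O(t^N). *)
Lemma jet0_coef N p : jet N (cst 0) p -> forall i, (i < N)%N -> p`_i = 0.
Proof.
elim: N p => [//|N IH] p [C pC].
have p0 : p.[0] = 0.
  have cp : p.[t] @[t --> 0^'] --> p.[0].
    by apply: cvg_within_filter; exact: continuous_horner.
  have c0 : p.[t] @[t --> 0^'] --> (0 : R).
    apply/cvgrPdist_le => e e0; near=> t.
    have t1 : `|t| <= 1 by near: t; exact: dnbhs0_le.
    have te : `|t| <= e / (`|C| + 1).
      by near: t; apply: dnbhs0_le; rewrite divr_gt0// ltr_wpDl.
    have : `|cst 0 t - p.[t]| <= C * `|t| ^+ N.+1 by near: t.
    rewrite /cst /= => /le_trans; apply.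
    have tN : `|t| ^+ N <= 1 by exact: exprn_ile1.
    have c1 : C * `|t| ^+ N.+1 <= `|C| * `|t|.
      rewrite exprS mulrA -[leRHS]mulr1.
      apply: (@le_trans _ _ (`|C| * `|t| * `|t| ^+ N)).
        by rewrite ler_wpM2r ?exprn_ge0// ler_wpM2r// ler_norm.
      by rewrite ler_wpM2l// mulr_ge0.
    have c2 : (`|C| + 1) * `|t| <= e.
      by rewrite mulrC -ler_pdivlMr// ltr_wpDl.
    by rewrite (le_trans c1)// (le_trans _ c2)// mulrDl mul1r lerDl.
  exact: (cvg_unique _ cp c0).
have /factor_theorem[q pE] : root p 0 by apply/eqP.
rewrite subr0 in pE.
have qj : jet N (cst 0) q.
  exists C; near=> t.
  have t0 : t != 0 by near: t; exact: nbhs_dnbhs_neq.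
  have : `|cst 0 t - p.[t]| <= C * `|t| ^+ N.+1 by near: t.
  rewrite pE hornerMX /cst /= !sub0r !normrN normrM exprSr mulrA.
  by rewrite ler_pM2r// normr_gt0.
by move=> [|i] iN; rewrite pE coefMX //=; exact: IH.
Unshelve. all: by end_near. Qed.

Lemma jet_uniq N f p q : jet N f p -> jet N f q ->
  forall i, (i < N)%N -> p`_i = q`_i.
Proof.
move=> fp fq i iN; apply/eqP; rewrite -subr_eq0 -coefB; apply/eqP.
apply: jet0_coef iN.
have := jetD fp (jetM fq (jet_poly N (-1)%:P)).
rewrite polyCN mulrN1; apply: jet_near; near=> t.
by rewrite hornerN hornerC mulrN1 subrr.
Unshelve. all: by end_near. Qed.

Lemma geometric_le2 (x : R) n : 0 <= x <= 1 / 2 -> \sum_(i < n) x ^+ i <= 2.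
Proof.
move=> /andP[x0 x1]; elim: n => [|n IH]; first by rewrite big_ord0.
rewrite big_ord_recl expr0 /=; under eq_bigr do rewrite exprS.
rewrite -mulr_sumr; have : x * \sum_(i < n) x ^+ i <= 1 / 2 * 2.
  by apply: ler_pM => //; apply: sumr_ge0 => i _; exact: exprn_ge0.
lra.
Qed.

Definition egf_poly N a : {poly R} := \poly_(k < N) (a k / k`!%:R).

(** At a fixed point t0 of convergence the terms are bounded, so that for
|t| <= t0 / 2 the tail of the series is dominated by a geometric one. *)
Lemma has_egf_jet N a f : has_egf a f -> jet N f (egf_poly N a).
Proof.
move=> af; have [r /= r0 rf] := af.
have {}rf t : t != 0 -> `|t| < r ->
    series (fun k => a k * t ^+ k / k`!%:R) @ \oo --> f t.
  by move=> t0 tr; apply: rf => //=; rewrite sub0r normrN.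
pose t0 := r / 2; have t0_gt0 : 0 < t0 by rewrite divr_gt0.
have [K K0 termK] : exists2 K, 0 <= K & forall k, `|a k * t0 ^+ k / k`!%:R| <= K.
  have cv : cvgn (series (fun k => a k * t0 ^+ k / k`!%:R)).
    apply/cvg_ex; exists (f t0); apply: rf; rewrite ?gt_eqF//.
    by rewrite gtr0_norm// ltr_pdivrMr// ltr_pMr// ltr1n.
  have /cvg_seq_bounded[M [_ /(_ (M + 1))]] : cvgn (fun k => a k * t0 ^+ k / k`!%:R).
    by apply/cvg_ex; exists 0; exact: cvg_series_cvg_0.
  rewrite ltrDl ltr01 => /(_ isT) MM; exists (M + 1); last by move=> k; exact: MM.
  by apply: le_trans (MM 0%N I).
exists (2 * K / t0 ^+ N); near=> t.
have tn0 : t != 0 by near: t; exact: nbhs_dnbhs_neq.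
have tt0 : `|t| <= t0 / 2 by near: t; apply: dnbhs0_le; rewrite divr_gt0.
have x0 : 0 <= `|t| / t0 <= 1 / 2.
  by rewrite divr_ge0 ?(ltW t0_gt0)//= ler_pdivrMr//; lra.
have tr : `|t| < r by apply: le_lt_trans tt0 _; rewrite /t0; lra.
have cv := rf t tn0 tr.
have partial m : (N <= m)%N ->
    `|series (fun k => a k * t ^+ k / k`!%:R) m - (egf_poly N a).[t]| <=
      2 * K / t0 ^+ N * `|t| ^+ N.
  move=> Nm; rewrite horner_poly -(big_mkord xpredT (fun i => a i / i`!%:R * t ^+ i)) /=.
  rewrite seriesEnat /= (@big_cat_nat _ _ _ N)//=.
  under eq_bigr do rewrite mulrAC.
  rewrite addrAC subrr add0r.
  apply: le_trans (ler_norm_sum _ _ _) _.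
  rewrite -{1}[N]add0n -(subnK Nm) big_addn addnK big_mkord.
  apply: (@le_trans _ _ (\sum_(i < m - N) K * (`|t| / t0) ^+ N * (`|t| / t0) ^+ i)).
    apply: ler_sum => i _.
    have -> : K * (`|t| / t0) ^+ N * (`|t| / t0) ^+ i = K * `|t| ^+ (i + N) / t0 ^+ (i + N).
      by rewrite -mulrA -exprD addnC expr_div_n mulrA.
    rewrite ler_pdivlMr ?exprn_gt0//.
    have := termK (i + N)%N; rewrite !normrM !normrX (gtr0_norm t0_gt0) => ?.
    rewrite mulrAC; apply: (@le_trans _ _ (`|a (i + N)%N| * t0 ^+ (i + N) * `|(i + N)`!%:R^-1| * `|t| ^+ (i + N))).
      by rewrite le_eqVlt; apply/orP; left; apply/eqP; ring.
    by rewrite ler_wpM2r// exprn_ge0.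
  rewrite -mulr_sumr expr_div_n.
  have -> : 2 * K / t0 ^+ N * `|t| ^+ N = K * (`|t| ^+ N / t0 ^+ N) * 2 by ring.
  apply: ler_wpM2l; last exact: geometric_le2.
  by rewrite mulr_ge0// divr_ge0 ?exprn_ge0 ?(ltW t0_gt0).
have cvn : `|series (fun k => a k * t ^+ k / k`!%:R) m - (egf_poly N a).[t]| @[m --> \oo]
    --> `|f t - (egf_poly N a).[t]|.
  by apply: cvg_norm; apply: cvgB; [exact: cv|exact: cvg_cst].
rewrite -(cvg_lim _ cvn)//; apply: limr_le; first by apply/cvg_ex; eexists; exact: cvn.
by exists N => // m; exact: partial.
Unshelve. all: by end_near. Qed.

Lemma near_scale (c : R) (P : R -> Prop) : c != 0 ->
  (\forall t \near 0^', P t) -> \forall t \near 0^', P (c * t).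
Proof.
move=> c0 [r /= r0 rP]; near=> t; apply: rP => /=.
  rewrite sub0r normrN normrM -ltr_pdivlMl ?normr_gt0// mulrC.
  by near: t; apply: dnbhs0_lt; rewrite divr_gt0// normr_gt0.
by rewrite mulf_neq0//; near: t; exact: nbhs_dnbhs_neq.
Unshelve. all: by end_near. Qed.

Lemma has_egf_scale (c : R) a f : c != 0 -> has_egf a f ->
  has_egf (fun k => c ^+ k * a k) (fun t => f (c * t)).
Proof.
move=> c0 /(near_scale c0); apply: filterS => t.
suff -> : (fun k => c ^+ k * a k * t ^+ k / k`!%:R) =
          (fun k => a k * (c * t) ^+ k / k`!%:R) by [].
by apply/funext => k; rewrite exprMn; ring.
Qed.

Lemma has_egf_expR : has_egf (fun=> 1 : R) expR.
Proof.
near=> t; rewrite /expR; under [X in series X]eq_fun do rewrite mul1r.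
exact: is_cvg_series_exp_coeff.
Unshelve. all: by end_near. Qed.

Lemma coef_egf_poly N a i : (i < N)%N -> (egf_poly N a)`_i = a i / i`!%:R.
Proof. by move=> iN; rewrite coef_poly iN. Qed.

Lemma big_even (F : nat -> R) j : (forall i, F i.*2.+1 = 0) ->
  \sum_(i < j.*2.+1) F i = \sum_(i < j.+1) F i.*2.
Proof.
move=> F0; elim: j => [|j IH]; first by rewrite !big_ord1.
by rewrite big_ord_recr [RHS]big_ord_recr /= -IH doubleS big_ord_recr /= F0 addr0.
Qed.

Lemma big_odd (F : nat -> R) j : (forall i, F i.*2 = 0) ->
  \sum_(i < j.*2) F i = \sum_(i < j) F i.*2.+1.
Proof.
move=> F0; elim: j => [|j IH]; first by rewrite !big_ord0.
by rewrite doubleS !big_ord_recr /= IH F0 addr0.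
Qed.

Lemma has_egf_expRN : has_egf (fun k => (-1) ^+ k : R) (fun t => expR (- t)).
Proof.
have /has_egf_scale/(_ has_egf_expR) : -1 != 0 :> R by rewrite oppr_eq0 oner_eq0.
apply: filterS => t; rewrite mulN1r.
suff -> : (fun k => (-1) ^+ k * 1 * t ^+ k / k`!%:R) =
          (fun k => (-1) ^+ k * t ^+ k / k`!%:R) by [].
by apply/funext => k; rewrite mulr1.
Qed.

Definition cosh_poly N : {poly R} :=
  (egf_poly N (fun=> 1) + egf_poly N (fun k => (-1) ^+ k)) * (1 / 2)%:P.

Definition sinh_poly N : {poly R} :=
  (egf_poly N (fun=> 1) + egf_poly N (fun k => (-1) ^+ k) * (-1)%:P) * (1 / 2)%:P.

Lemma jet_cosh N : jet N (@cosh R) (cosh_poly N).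
Proof.
have := jetM (jetD (has_egf_jet N has_egf_expR) (has_egf_jet N has_egf_expRN))
  (jet_poly N (1 / 2)%:P).
by apply: jet_near; near=> t; rewrite hornerC mul1r.
Unshelve. all: by end_near. Qed.

Lemma jet_sinh N : jet N (fun t => (expR t - expR (- t)) / 2) (sinh_poly N).
Proof.
have := jetM (jetD (has_egf_jet N has_egf_expR)
  (jetM (has_egf_jet N has_egf_expRN) (jet_poly N (-1)%:P))) (jet_poly N (1 / 2)%:P).
by apply: jet_near; near=> t; rewrite !hornerC mul1r mulrN1.
Unshelve. all: by end_near. Qed.

Lemma signr_double i : (-1) ^+ i.*2 = 1 :> R.
Proof. by rewrite -signr_odd odd_double. Qed.

Lemma coef_cosh_poly N i : (i < N)%N ->
  (cosh_poly N)`_i = if odd i then 0 else i`!%:R^-1.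
Proof.
move=> iN; rewrite coefMC coefD !coef_egf_poly// -signr_odd.
by case: (odd i); rewrite ?expr1 ?expr0; lra.
Qed.

Lemma coef_sinh_poly N i : (i < N)%N ->
  (sinh_poly N)`_i = if odd i then i`!%:R^-1 else 0.
Proof.
move=> iN; rewrite coefMC coefD coefMC !coef_egf_poly// -signr_odd.
by case: (odd i); rewrite ?expr1 ?expr0; lra.
Qed.

Lemma cosh_gt0 (t : R) : 0 < cosh t.
Proof. by rewrite divr_gt0// addr_gt0// expR_gt0. Qed.

(** The coefficient of z^(2l) in sec z = 1 / cosh (i z). *)
Definition secant_coef (E : nat -> R) l : R := (-1) ^+ l * E l.*2 / (l.*2)`!%:R.

(** The coefficient of z^(2j) in cos z * sec z = 1. *)
Lemma secant_coef_rec E : euler_numbers E -> forall j,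
  \sum_(i < j.+1) (-1) ^+ i / (i.*2)`!%:R * secant_coef E (j - i) = (j == 0%N)%:R.
Proof.
move=> hE j; pose N := j.*2.+1.
have prod : jet N (horner 1) (cosh_poly N * egf_poly N E).
  apply: jet_near (jetM (jet_cosh N) (has_egf_jet N hE)); near=> t.
  by rewrite hornerC divff// gt_eqF// cosh_gt0.
have := jet_uniq prod (jet_poly N 1) (ltnSn j.*2).
rewrite coefM coef1 double_eq0.
pose F i : R := if odd i then 0 else i`!%:R^-1 * (E (j.*2 - i)%N / (j.*2 - i)`!%:R).
rewrite (eq_bigr (fun i : 'I_N => F i)) => [|i _]; last first.
  rewrite coef_cosh_poly// coef_egf_poly; last by rewrite ltnS leq_subr.
  by rewrite /F; case: odd; rewrite ?mul0r.
rewrite big_even => [Ej|i]; last by rewrite /F /= odd_double.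
have -> : (j == 0%N)%:R = (-1) ^+ j * (j == 0%N)%:R :> R.
  by case: j {N prod F Ej} => [|j]; rewrite ?mulr0 ?expr0 ?mul1r.
rewrite -Ej mulr_sumr; apply: eq_bigr => i _.
have ij : (i <= j)%N by rewrite -ltnS.
have -> : (-1) ^+ j = (-1) ^+ i * (-1) ^+ (j - i) :> R by rewrite -exprD subnKC.
by rewrite /F odd_double /secant_coef -doubleB; ring.
Unshelve. all: by end_near. Qed.

(** The identity t tanh t = t - b(2t) + b(4t) with b(t) = t / (e^t - 1), which
expresses tan through Bernoulli numbers. *)
Lemma tanh_bernoulli (t : R) : t != 0 ->
  t * ((expR t - expR (- t)) / 2) / cosh t =
  t - 2 * t / (expR (2 * t) - 1) + 4 * t / (expR (4 * t) - 1).
Proof.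
move=> t0; rewrite /cosh expRN.
have -> : 4 * t = 2 * t + 2 * t by ring.
have -> : 2 * t = t + t by ring.
rewrite !expRD.
have y0 := expR_gt0 t.
have y1 : expR t != 1 by rewrite -expR0 (inj_eq (@expR_inj R)).
have yy0 : expR t * expR t + 1 != 0 by rewrite gt_eqF// addr_gt0// mulr_gt0.
have yy1 : expR t * expR t - 1 != 0.
  have -> : expR t * expR t - 1 = (expR t - 1) * (expR t + 1) by ring.
  by rewrite mulf_neq0 ?subr_eq0// gt_eqF// addr_gt0.
field; rewrite yy0 yy1 (gt_eqF y0) !andbT.
have -> : expR t * expR t * (expR t * expR t) - 1 =
  (expR t * expR t - 1) * (expR t * expR t + 1) by ring.
by rewrite mulf_neq0.
Qed.

(** Both sides are the coefficient of z^(2j+1) in tan z: on the left it is read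
from sin z * sec z, on the right from tanh_bernoulli. *)
Lemma bernoulli_secant B E : bernoulli_numbers B -> euler_numbers E -> forall j,
  \sum_(i < j.+1) (-1) ^+ i / (i.*2.+1)`!%:R * secant_coef E (j - i) =
  (-1) ^+ j * (4 ^+ j.+1.*2 - 2 ^+ j.+1.*2) * B j.+1.*2 / (j.+1.*2)`!%:R.
Proof.
move=> hB hE j; pose N := j.+1.*2.+1.
have n2 : 2 != 0 :> R by rewrite pnatr_eq0.
have n4 : 4 != 0 :> R by rewrite pnatr_eq0.
have jl := jetM (jetM (jet_poly N 'X) (jet_sinh N)) (has_egf_jet N hE).
have jr := jetD (jetD (jet_poly N 'X)
  (jetM (has_egf_jet N (has_egf_scale n2 hB)) (jet_poly N (-1)%:P)))
  (has_egf_jet N (has_egf_scale n4 hB)).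
have jrl : jet N (fun t => 'X.[t] * ((expR t - expR (- t)) / 2) / cosh t)
  ('X + egf_poly N (fun k => 2 ^+ k * B k) * (-1)%:P + egf_poly N (fun k => 4 ^+ k * B k)).
  apply: jet_near jr; near=> t.
  have t0 : t != 0 by near: t; exact: nbhs_dnbhs_neq.
  by rewrite hornerC mulrN1 hornerX tanh_bernoulli.
have := jet_uniq jl jrl (ltnSn j.+1.*2).
rewrite -mulrA mulrC coefMX !coefD coefMC !coef_egf_poly// coefX doubleS /= add0r.
rewrite coefM.
pose F i : R := if odd i then i`!%:R^-1 * (E (j.*2.+1 - i)%N / (j.*2.+1 - i)`!%:R) else 0.
rewrite (eq_bigr (fun i : 'I_(j.*2.+2) => F i)) => [|i _]; last first.
  have iN : (i < N)%N by rewrite ltnW// /N doubleS ltnS; exact: ltn_ord.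
  rewrite coef_sinh_poly// coef_egf_poly; last first.
    by rewrite /N doubleS ltnS (leq_trans (leq_subr _ _)).
  by rewrite /F; case: odd; rewrite ?mul0r.
rewrite (@big_odd F j.+1) => [Ej|i]; last by rewrite /F odd_double.
transitivity ((-1) ^+ j * \sum_(i < j.+1) F i.*2.+1); last by rewrite Ej; ring.
rewrite mulr_sumr; apply: eq_bigr => i _.
have ij : (i <= j)%N by rewrite -ltnS.
have -> : (-1) ^+ j = (-1) ^+ i * (-1) ^+ (j - i) :> R by rewrite -exprD subnKC.
by rewrite /F /= odd_double /= subSS /secant_coef -doubleB; ring.
Unshelve. all: by end_near. Qed.


End Jets.

(** * Comparison for odd functions of even order *)

Section Comparison.
Context {R : realType}.
Implicit Types (h M u v : R) (g : R -> R).

Lemma MVT_itv (g dg : R -> R) (a b : R) : a < b ->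
  (forall u, a <= u <= b -> is_derive u 1 g (dg u)) ->
  exists2 c, a < c < b & g b - g a = dg c * (b - a).
Proof.
move=> ab gd.
have [u||c cab E] := @MVT R g dg a b ab.
- by rewrite in_itv => /= /andP[au ub]; apply: gd; rewrite !ltW.
- apply: derivable_within_continuous => u; rewrite in_itv => /= uab.
  by have [] := gd u uab.
- by exists c => //; move: cab; rewrite in_itv.
Qed.

(** A function with nonincreasing derivative is concave, so that it lies above
its chord, here the zero function. *)
Lemma concave_ge0 h g (dg : R -> R) : 0 < h ->
  (forall u, 0 <= u <= h -> is_derive u 1 g (dg u)) ->
  (forall u v, 0 <= u -> u <= v -> v <= h -> dg v <= dg u) ->
  g 0 = 0 -> g h = 0 ->
  (forall u, 0 <= u <= h -> 0 <= g u) /\ 0 <= dg 0.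
Proof.
move=> h0 gd dgN g0 gh; split=> [u /andP[u0 uh]|].
- rewrite leNgt; apply/negP => gu.
  have {}u0 : 0 < u by rewrite lt_neqAle u0 andbT; apply/eqP => E; rewrite -E g0 ltxx in gu.
  have {}uh : u < h by rewrite lt_neqAle uh andbT; apply/eqP => E; rewrite E gh ltxx in gu.
  have [v /andP[v0 vu]|c /andP[c0 cu] Ec] := @MVT_itv g dg 0 u u0.
    by apply: gd; rewrite v0 (le_trans vu)// ltW.
  have [v /andP[v0 vu]|d /andP[d0 du] Ed] := @MVT_itv g dg u h uh.
    by apply: gd; rewrite vu (le_trans _ v0)// ltW.
  have dcd : dg d <= dg c by apply: dgN; rewrite ltW//; exact: lt_trans d0.
  have dc : dg c < 0.
    by rewrite -(@pmulr_llt0 _ u)//; move: Ec; rewrite g0 !subr0 => <-.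
  have : 0 < dg d * (h - u) by rewrite -Ed gh sub0r oppr_gt0.
  by rewrite pmulr_lgt0 ?subr_gt0// => /lt_le_trans/(_ dcd); rewrite ltNge (ltW dc).
- have [c /andP[c0 ch] E] := MVT_itv h0 gd.
  have /eqP : dg c * h = 0 by rewrite -[in LHS](subr0 h) -E g0 gh subrr.
  rewrite mulf_eq0 (gt_eqF h0) orbF => /eqP c_eq0; rewrite -[leLHS]c_eq0.
  by apply: dgN; lra.
Qed.

Lemma is_derive_horner (p : {poly R}) u : is_derive u 1 (horner p) (p^`()).[u].
Proof.
have := @derivable_horner R p u => pd.
by apply: DeriveDef => //; rewrite -derive1E -derivE.
Qed.

(** Downward induction on the order: once |Z''| <= M e_k is known, the
inequality (M e_{k+1} - Z)'' = - M e_k - Z'' <= 0 makes M e_{k+1} - Z concave,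
and likewise for M e_{k+1} + Z.  At the top order, Z^(2k+1) is M-Lipschitz
while (M e_1)' has slope -M.  The sign s treats both bounds at once. *)
Lemma lidstone_comparison h M (e : nat -> {poly R}) : 0 < h -> 0 <= M ->
  e 0%N = 1 ->
  (forall j, (e j.+1)^`()^`() = - e j) ->
  (forall j, (e j.+1).[0] = 0 /\ (e j.+1).[h] = 0) ->
  forall k (Z : nat -> R -> R),
  (forall i u, (i <= k.*2)%N -> 0 <= u <= h -> is_derive u 1 (Z i) (Z i.+1 u)) ->
  (forall u v, 0 <= u -> u <= v -> v <= h ->
     `|Z k.*2.+1 v - Z k.*2.+1 u| <= M * (v - u)) ->
  (forall j, (j <= k)%N -> Z j.*2 0 = 0 /\ Z j.*2 h = 0) ->
  (forall u, 0 <= u <= h -> `|Z 0%N u| <= M * (e k.+1).[u]) /\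
  `|Z 1%N 0| <= M * ((e k.+1)^`()).[0].
Proof.
move=> h0 M0 e0 de ebd.
(* the bound for Z at order k.+1 needs the one for -Z'' at order k *)
suff pos : forall (s : bool) k (Z : nat -> R -> R),
  (forall i u, (i <= k.*2)%N -> 0 <= u <= h -> is_derive u 1 (Z i) (Z i.+1 u)) ->
  (forall u v, 0 <= u -> u <= v -> v <= h ->
     `|Z k.*2.+1 v - Z k.*2.+1 u| <= M * (v - u)) ->
  (forall j, (j <= k)%N -> Z j.*2 0 = 0 /\ Z j.*2 h = 0) ->
  (forall u, 0 <= u <= h -> 0 <= M * (e k.+1).[u] - (-1) ^+ s * Z 0%N u) /\
  0 <= M * ((e k.+1)^`()).[0] - (-1) ^+ s * Z 1%N 0.
  move=> k Z Zd ZL Z0.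
  have [p1 p2] := pos false k Z Zd ZL Z0; have [q1 q2] := pos true k Z Zd ZL Z0.
  split=> [u uh|]; last by rewrite ler_norml; move: p2 q2; rewrite expr0 expr1; lra.
  by rewrite ler_norml; move: (p1 u uh) (q1 u uh); rewrite expr0 expr1; lra.
have sgE (s : bool) : (-1) ^+ s = 1 :> R \/ (-1) ^+ s = -1 :> R by case: s; [right|left].
move=> s k; elim: k s => [|k IH] s Z Zd ZL Z0.
- pose dg u := M * ((e 1%N)^`()).[u] - (-1) ^+ s * Z 1%N u.
  pose g u := M * (e 1%N).[u] - (-1) ^+ s * Z 0%N u.
  have gd u : 0 <= u <= h -> is_derive u 1 g (dg u).
    move=> uh; have := Zd 0%N u isT uh => Zu.
    have eu := is_derive_horner (e 1%N) u.
    by apply: is_deriveB; apply: is_deriveZ.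
  have dgN u v : 0 <= u -> u <= v -> v <= h -> dg v <= dg u.
    move=> u0 uv vh; have [->//|uv'] := eqVneq u v.
    have ltuv : u < v by rewrite lt_neqAle uv' uv.
    have [c cuv E] := MVT_itv ltuv (fun w _ => is_derive_horner (e 1%N)^`() w).
    have := ZL u v u0 uv vh; rewrite de e0 hornerN hornerC in E.
    rewrite ler_norml /dg.
    have -> : (e 1%N)^`().[v] = (e 1%N)^`().[u] - (v - u) by lra.
    by case: (sgE s) => ->; lra.
  have g0 : g 0 = 0.
    by rewrite /g; have [-> _] := ebd 0%N; have [-> _] := Z0 0%N isT; rewrite !mulr0 subrr.
  have gh : g h = 0.
    by rewrite /g; have [_ ->] := ebd 0%N; have [_ ->] := Z0 0%N isT; rewrite !mulr0 subrr.
  exact: concave_ge0 h0 gd dgN g0 gh.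
- have [|u v|j jk|IHe _] := IH (~~ s) (fun i => Z i.+2).
  + by move=> i u ik uh; apply: Zd => //; rewrite doubleS !ltnS.
  + by move=> ? ? ?; have := ZL u v; rewrite doubleS; exact.
  + by have := Z0 j.+1; rewrite doubleS; apply.
  pose dg u := M * ((e k.+2)^`()).[u] - (-1) ^+ s * Z 1%N u.
  pose ddg u := M * ((e k.+2)^`()^`()).[u] - (-1) ^+ s * Z 2%N u.
  have dgd u : 0 <= u <= h -> is_derive u 1 dg (ddg u).
    move=> uh; have := Zd 1%N u isT uh => Zu.
    have eu := is_derive_horner (e k.+2)^`() u.
    by apply: is_deriveB; apply: is_deriveZ.
  pose g u := M * (e k.+2).[u] - (-1) ^+ s * Z 0%N u.
  have gd u : 0 <= u <= h -> is_derive u 1 g (dg u).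
    move=> uh; have := Zd 0%N u isT uh => Zu.
    have eu := is_derive_horner (e k.+2) u.
    by apply: is_deriveB; apply: is_deriveZ.
  have dgN u v : 0 <= u -> u <= v -> v <= h -> dg v <= dg u.
    move=> u0 uv vh; have [->//|uv'] := eqVneq u v.
    have {uv'}ltuv : u < v by rewrite lt_neqAle uv' uv.
    have [w /andP[uw wv]|c /andP[uc cv] E] := @MVT_itv dg ddg u v ltuv.
      by apply: dgd; rewrite (le_trans u0)// (le_trans wv).
    rewrite -subr_le0 E pmulr_lle0 ?subr_gt0// /ddg de hornerN.
    have := IHe c; rewrite (le_trans u0 (ltW uc)) (le_trans (ltW cv) vh) => /(_ isT).
    have /= -> : (-1) ^+ (~~ s) = - (-1) ^+ s :> R by rewrite signrN.
    by case: (sgE s) => ->; lra.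
  have g0 : g 0 = 0.
    by rewrite /g; have [-> _] := ebd k.+1; have [-> _] := Z0 0%N isT; rewrite !mulr0 subrr.
  have gh : g h = 0.
    by rewrite /g; have [_ ->] := ebd k.+1; have [_ ->] := Z0 0%N isT; rewrite !mulr0 subrr.
  exact: concave_ge0 h0 gd dgN g0 gh.
Qed.


(** The coefficient of z^(2j) in cos(z(u - h/2)) / cos(z h/2), as a polynomial in
u, where sigma_l is the coefficient of z^(2l) in sec z.  Centred at h/2, it is
visibly even about that point. *)
Definition lidstone_poly (h : R) (sigma : nat -> R) (j : nat) : {poly R} :=
  \sum_(i < j.+1) ((-1) ^+ i / (i.*2)`!%:R * (h / 2) ^+ (j - i).*2 * sigma (j - i)%N)
    *: ('X - (h / 2)%:P) ^+ i.*2.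

Section SecantSequence.
Variables (h : R) (sigma : nat -> R).
Hypothesis h_gt0 : 0 < h.
Hypothesis sigma_rec : forall j,
  \sum_(i < j.+1) (-1) ^+ i / (i.*2)`!%:R * sigma (j - i)%N = (j == 0%N)%:R.

Let e := lidstone_poly h sigma.

Lemma lidstone_poly0 : e 0 = 1.
Proof.
have s0 : sigma 0 = 1.
  by have := sigma_rec 0; rewrite big_ord1 /= fact0 expr0 divr1 mul1r.
by rewrite /e /lidstone_poly big_ord1 /= s0 fact0 !expr0 divr1 !mul1r scale1r.
Qed.

Lemma factr_neq0 k : (k`!)%:R != 0 :> R.
Proof. by rewrite pnatr_eq0 -lt0n fact_gt0. Qed.

Lemma factrS k : (k.+1)`!%:R = k.+1%:R * k`!%:R :> R.
Proof. by rewrite factS natrM. Qed.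

Lemma deriv_XsubC_exp (c : R) k :
  (('X - c%:P) ^+ k.+1)^`() = k.+1%:R *: ('X - c%:P) ^+ k.
Proof. by rewrite deriv_exp derivXsubC mul1r scaler_nat. Qed.

Lemma deriv_lidstone_poly j : (e j.+1)^`() =
  \sum_(i < j.+1) ((-1) ^+ i.+1 / (i.*2.+1)`!%:R * (h / 2) ^+ (j - i).*2 * sigma (j - i)%N)
    *: ('X - (h / 2)%:P) ^+ i.*2.+1.
Proof.
rewrite /e /lidstone_poly raddf_sum big_ord_recl /= expr0 derivZ derivC scaler0 add0r.
apply: eq_bigr => i _; rewrite /bump leq0n add1n subSS derivZ doubleS deriv_XsubC_exp scalerA.
congr (_ *: _); rewrite (factrS i.*2.+1).
by field; rewrite factr_neq0 /= -natrD pnatr_eq0.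
Qed.

Lemma deriv2_lidstone_poly j : (e j.+1)^`()^`() = - e j.
Proof.
rewrite deriv_lidstone_poly raddf_sum /= /e /lidstone_poly -sumrN.
apply: eq_bigr => i _; rewrite derivZ deriv_XsubC_exp scalerA -scaleNr.
by congr (_ *: _); rewrite (factrS i.*2) exprS; field; rewrite factr_neq0 /= nat1r pnatr_eq0.
Qed.

Lemma lidstone_poly_bd j : (e j.+1).[0] = 0 /\ (e j.+1).[h] = 0.
Proof.
have hh : h - h / 2 = h / 2 by lra.
suff bd c : (c - h / 2) ^+ 2 = (h / 2) ^+ 2 -> (e j.+1).[c] = 0.
  by split; apply: bd; rewrite ?hh// sub0r sqrrN.
move=> cE; have /(congr1 (fun y => (h / 2) ^+ j.+1.*2 * y)) := sigma_rec j.+1.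
rewrite mulr0 mulr_sumr => <-; rewrite /e /lidstone_poly horner_sum.
apply: eq_bigr => i _; rewrite hornerZ horner_exp hornerXsubC.
have -> : (c - h / 2) ^+ i.*2 = (h / 2) ^+ i.*2 by rewrite -mul2n !exprM cE.
have -> : j.+1.*2 = ((j.+1 - i).*2 + i.*2)%N by rewrite -doubleD subnK// -ltnS.
by rewrite exprD; ring.
Qed.

Lemma lidstone_poly_mid j : (e j).[h / 2] = (h / 2) ^+ j.*2 * sigma j.
Proof.
rewrite /e /lidstone_poly horner_sum big_ord_recl big1 => [|i _].
  by rewrite addr0 hornerZ /= !expr0 fact0 hornerC subn0; field.
by rewrite lift0 doubleS hornerZ horner_exp hornerXsubC subrr expr0n /= mulr0.
Qed.

Lemma deriv_lidstone_poly_left j : (e j.+1)^`().[0] = (h / 2) ^+ j.*2.+1 *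
   \sum_(i < j.+1) (-1) ^+ i / (i.*2.+1)`!%:R * sigma (j - i)%N.
Proof.
rewrite deriv_lidstone_poly horner_sum mulr_sumr; apply: eq_bigr => i _.
rewrite hornerZ horner_exp hornerXsubC sub0r (exprNn (h / 2)).
have -> : j.*2.+1 = ((j - i).*2 + i.*2.+1)%N.
  by rewrite addnS -doubleD subnK// -ltnS.
have -> : (-1) ^+ i.*2.+1 = -1 :> R by rewrite -signr_odd /= odd_double.
by rewrite exprD (exprS _ i); ring.
Qed.

Lemma deriv_lidstone_poly_mid j : (e j.+1)^`().[h / 2] = 0.
Proof.
rewrite deriv_lidstone_poly horner_sum big1// => i _.
by rewrite hornerZ horner_exp hornerXsubC subrr expr0n /= mulr0.
Qed.

(** Comparison with the zero function. *)
Lemma lidstone_poly_ge0 j u : 0 <= u <= h -> 0 <= (e j).[u].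
Proof.
case: j => [|j] uh; first by rewrite lidstone_poly0 hornerC.
have [] := @lidstone_comparison h 1 e h_gt0 ler01 lidstone_poly0
  deriv2_lidstone_poly lidstone_poly_bd j (fun _ _ => 0).
- by move=> u' v _ uv _; rewrite subrr normr0 mul1r subr_ge0.
- by [].
- by move=> /(_ u uh); rewrite normr0 mul1r.
Qed.

(** Concavity, with critical point h/2. *)
Lemma lidstone_poly_max j u : 0 <= u <= h -> (e j).[u] <= (e j).[h / 2].
Proof.
case: j => [|j] /andP[u0 uh]; first by rewrite lidstone_poly0 !hornerC.
have dN a b : 0 <= a -> a < b -> b <= h -> (e j.+1)^`().[b] <= (e j.+1)^`().[a].
  move=> a0 ab bh.
  have [c /andP[ac cb] E] := MVT_itv ab (fun w _ => is_derive_horner (e j.+1)^`() w).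
  rewrite -subr_le0 E pmulr_lle0 ?subr_gt0// deriv2_lidstone_poly hornerN oppr_le0.
  by apply: lidstone_poly_ge0; lra.
rewrite -subr_ge0; have [uh2|uh2|->] := ltgtP u (h / 2); last by rewrite subrr.
- have [c /andP[uc ch] ->] := MVT_itv uh2 (fun w _ => is_derive_horner (e j.+1) w).
  rewrite pmulr_lge0 ?subr_gt0// -(deriv_lidstone_poly_mid j); apply: dN; lra.
- have [c /andP[uc ch] E] := MVT_itv uh2 (fun w _ => is_derive_horner (e j.+1) w).
  rewrite -opprB E oppr_ge0 pmulr_lle0 ?subr_gt0// -(deriv_lidstone_poly_mid j).
  apply: dN; lra.
Qed.

End SecantSequence.
End Comparison.

(** * Monotonicity of absolutely continuous functions *)

Section AbsoluteContinuity.
Context {R : realType}.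

(** The supremum of the points reached from u satisfies P, by the left step, and
cannot lie before w, by the right step. *)
Lemma real_induction (P : R -> Prop) (u w : R) : u <= w -> P u ->
  (forall c, u <= c <= w -> exists2 d, 0 < d &
     (forall s, u <= s <= c -> c - d < s -> P s -> P c) /\
     (forall s, c <= s <= w -> s < c + d -> P c -> P s)) ->
  P w.
Proof.
move=> uw Pu step.
pose E := [set v | u <= v <= w /\ P v].
have Eu : E u by split; rewrite // lexx.
have supE : has_sup E by split; [exists u | exists w => v [/andP[]]].
have uc : u <= sup E by exact: sup_upper_bound.
have cw : sup E <= w by apply: ge_sup; [exists u | move=> v [/andP[]]].
have [|d d0 [stepL stepR]] := step (sup E); first by rewrite uc.
have Pc : P (sup E).
  have [v [/andP[uv vw] Pv] lv] := sup_adherent d0 supE.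
  by apply: (stepL v) => //; rewrite uv sup_upper_bound//; split; rewrite ?uv.
have [->//|cw'] := eqVneq w (sup E).
have {cw' cw}cw : sup E < w by rewrite lt_neqAle eq_sym cw' cw.
pose s := Num.min w (sup E + d / 2).
have cs : sup E < s by rewrite lt_min cw ltrDl divr_gt0.
have : s <= sup E.
  apply: sup_upper_bound => //; split.
    by rewrite (le_trans uc (ltW cs)) ge_min lexx.
  apply: stepR => //; first by rewrite (ltW cs) ge_min lexx.
  by rewrite gt_min ltrD2l [_ / 2 < _]ltr_pdivrMr// ltr_pMr// ltr1n orbT.
by rewrite leNgt cs.
Qed.

(** A finite family of nonoverlapping segments of [u, v] with interiors in U,
listed from right to left, so that a segment can be added at the right end
while moving rightwards. *)
Fixpoint stacked (U : set R) (u v : R) (l : seq (R * R)) : Prop :=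
  if l is p :: l' then
    [/\ p.1 <= p.2, p.2 <= v, `]p.1, p.2[ `<=` U & stacked U u p.1 l']
  else u <= v.

Lemma stacked_bounds U u v l : stacked U u v l ->
  u <= v /\ forall i, (i < size l)%N ->
    let p := nth (0, 0) l i in
    [/\ u <= p.1, p.1 <= p.2, p.2 <= v & `]p.1, p.2[ `<=` U].
Proof.
elim: l v => [|p l IH] v //= [p12 p2v pU /IH[up IHl]].
split; first by rewrite (le_trans up)// (le_trans p12).
move=> [|i] /= il; first by split.
have [a b c d] := IHl i il; split=> //.
by rewrite (le_trans c)// (le_trans p12).
Qed.

Lemma stacked_widen U u v v' l : v <= v' -> stacked U u v l -> stacked U u v' l.
Proof.
case: l => [|p l] /= vv'; first by move=> uv; exact: le_trans vv'.
by move=> [p12 p2v pU sl]; split=> //; exact: le_trans vv'.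
Qed.

Lemma stacked_ordered U u v l i j : stacked U u v l ->
  (i < j < size l)%N -> (nth (0, 0) l j).2 <= (nth (0, 0) l i).1.
Proof.
elim: l v i j => [|p l IH] v i j /=; first by rewrite ltn0 andbF.
move=> [p12 p2v pU sl]; case: j => [|j]; first by rewrite ltn0.
case: i => [|i] /= jl; last exact: IH sl _.
by have [_ /(_ j jl)[]] := stacked_bounds sl.
Qed.

Definition stack_interval (l : seq (R * R)) (i : nat) : set R :=
  `](nth (0, 0) l i).1, (nth (0, 0) l i).2[%classic.

Lemma stack_interval_default l i : (size l <= i)%N -> stack_interval l i = set0.
Proof. by move=> li; rewrite /stack_interval nth_default//= set_itvoo0. Qed.

Lemma stacked_trivIset U u v l : stacked U u v l -> trivIset setT (stack_interval l).
Proof.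
move=> sl; apply: ltn_trivIset => j i ij.
have [li|jl] := leqP (size l) j; first by rewrite (stack_interval_default li) setI0.
have := @stacked_ordered _ _ _ _ i j sl; rewrite ij jl => /(_ isT) lt.
apply/seteqP; split=> // x []; rewrite /stack_interval /= !in_itv/= => /andP[ix _] /andP[_ xj].
by have := lt_trans (lt_le_trans xj lt) ix; rewrite ltxx.
Qed.

(** The interiors are disjoint and contained in U. *)
Lemma stacked_length U u v l : open U -> stacked U u v l ->
  ((\sum_(i < size l) ((nth (0, 0) l i).2 - (nth (0, 0) l i).1))%:E
     <= lebesgue_measure U)%E.
Proof.
move=> oU sl; have [_ bnd] := stacked_bounds sl.
have -> : ((\sum_(i < size l) ((nth (0, 0) l i).2 - (nth (0, 0) l i).1))%:E
     = \sum_(i < size l) lebesgue_measure (stack_interval l i))%E.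
  rewrite -sumEFin; apply: eq_bigr => i _.
  rewrite lebesgue_measure_itv /= lte_fin EFinN -EFinB.
  have [//|le21] := ltP.
  have [_ le12 _ _] := bnd i (ltn_ord i).
  by rewrite [X in X - _](@le_anti _ _ _ (nth (0, 0) l i).1) ?subrr// le21.
rewrite -measure_bigsetU//; last exact: stacked_trivIset sl.
  apply: le_measure; rewrite ?inE//.
  - by apply: bigsetU_measurable => i _; exact: measurable_itv.
  - exact: open_measurable.
  - rewrite -bigcup_mkord; apply: bigcup_sub => i il.
    by have [] := bnd i il.
by move=> i; exact: measurable_itv.
Qed.

(** Cover the exceptional null set by an open set U of measure less than the
modulus d of absolute continuity.  Moving from u to w, near a point outside the
null set f decreases by at most e times the distance travelled, and near a
point of U the move is recorded as a segment inside U.  The recorded segments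
have total length less than d, so that f varies by less than e on them. *)
Lemma AC_nondecreasing (T : R) (f : R -> R) :
  absolutely_continuous_in `[0, T] f ->
  (\forall t \ae leb T, t \in `[0, T] -> forall e, 0 < e ->
     \forall s \near within `[0, T] t^', - e <= (s - t)^-1 * (f s - f t)) ->
  forall u w, 0 <= u -> u <= w -> w <= T -> f u <= f w.
Proof.
move=> ACf [N [mN N0 Nbad]] u w u0 uw wT.
pose D : set R := N `&` `[0, T].
have mD : measurable D by apply: measurableI => //; exact: measurable_itv.
have D0 : lebesgue_measure D = 0%E by [].
suff bound e : 0 < e -> - e * (w - u) - e <= f w - f u.
  rewrite leNgt; apply/negP => fwu.
  have c0 : 0 < w - u + 1 by lra.
  have := bound ((f u - f w) / (w - u + 1) / 2).
  rewrite !divr_gt0 ?subr_gt0// => /(_ isT).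
  have : (f u - f w) / (w - u + 1) * (w - u + 1) = f u - f w.
    by rewrite divfK// gt_eqF.
  lra.
move=> e0; have [d d0 ACd] := ACf e e0.
have [|U [oU DU lU]] := lebesgue_regularity_outer mD _ d0.
  by apply: (@le_lt_trans _ _ 0%E); [rewrite le_eqVlt; apply/orP; left; apply/eqP; exact: D0|exact: ltry].
have {}lU : (lebesgue_measure U < d%:E)%E.
  have mU : measurable U := open_measurable oU.
  have DI : lebesgue_measure U =
      (lebesgue_measure (U `\` D) + lebesgue_measure (U `&` D))%E.
    by apply: (@measureDI _ _ _ lebesgue_measure U D).
  have UD0 : lebesgue_measure (U `&` D) = 0%E.
    by apply: (@subset_measure0 _ _ _ lebesgue_measure _ D) => //; exact: measurableI.
  by rewrite DI UD0 adde0; exact: lU.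
(* f has decreased by at most e (v - u), apart from the recorded segments *)
pose S v := exists2 l, stacked U u v l &
  - e * (v - u) - \sum_(p <- l) `|f p.2 - f p.1| <= f v - f u.
have step p q : p <= q -> S p -> - e * (q - p) <= f q - f p \/ `]p, q[ `<=` U -> S q.
  have eE : - e * (q - u) = - e * (p - u) + - e * (q - p) by ring.
  move=> pq [l sl lp] [good|bad].
    by exists l; [exact: stacked_widen sl|move: lp good; rewrite eE; lra].
  exists ((p, q) :: l) => //=.
  rewrite big_cons /= eE.
  have : 0 <= e * (q - p) by apply: mulr_ge0; lra.
  have : - `|f q - f p| <= f q - f p by rewrite lerNl -normrN; exact: ler_norm.
  move: lp; lra.
have [l sl lw] : S w.
  apply: (real_induction uw); first by exists [::]; rewrite /= ?big_nil ?subrr ?mulr0 ?lexx // subrr.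
  move=> c /andP[uc cw].
  have cT : c \in `[0, T] by rewrite in_itv/= (le_trans u0 uc) (le_trans cw wT).
  have [d' d'0 near_c] : exists2 d', 0 < d' & forall p q, u <= p -> p <= q -> q <= w ->
      p = c \/ q = c -> c - d' < p -> q < c + d' ->
      - e * (q - p) <= f q - f p \/ `]p, q[ `<=` U.
    have [Nc|Nc] := pselect (N c).
      have /oU : U c by apply: DU; split.
      rewrite /interior /= -nbhs_ballE => -[d' d'0 bU]; exists d' => // p q _ pq _ _ cp qc.
      right=> x; rewrite /= in_itv/= => /andP[px xq]; apply: bU.
      rewrite /ball/= ltr_norml; lra.
    have /(_ e e0) : forall e, 0 < e ->
       \forall s \near within `[0, T] c^', - e <= (s - c)^-1 * (f s - f c).
      by apply: contrapT => nc; apply: Nc; apply: Nbad => /(_ cT).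
    rewrite near_withinE => -[d' /= d'0 bc]; exists d' => // p q up pq qw.
    have [-> _ _ _|npq] := eqVneq p q; first by left; rewrite !subrr mulr0.
    have {npq pq}pq : p < q by rewrite lt_neqAle npq pq.
    case=> E cp qc; left.
      subst p; have := bc q; rewrite /ball /= ltr_norml.
      have -> : - d' < c - q < d' by lra.
      rewrite in_itv /= (gt_eqF pq) => /(_ isT isT).
      have -> : (0 <= q <= T) = true by lra.
      move=> /(_ isT); rewrite mulrC ler_pdivlMr ?subr_gt0//.
    subst q; have := bc p; rewrite /ball /= ltr_norml.
    have -> : - d' < c - p < d' by lra.
    rewrite in_itv /= (lt_eqF pq) => /(_ isT isT).
    have -> : (0 <= p <= T) = true by lra.
    move=> /(_ isT); rewrite -mulrNN -invrN !opprB mulrC ler_pdivlMr ?subr_gt0//.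
  exists d' => //; split=> s /andP[s1 s2] s3 Ss.
    by apply: (step s) => //; apply: near_c => //; [right|lra].
  by apply: (step c) => //; apply: near_c => //; first [by left|lra].
suff : \sum_(p <- l) `|f p.2 - f p.1| < e by lra.
have [_ bnd] := stacked_bounds sl.
rewrite (big_nth (0, 0)) big_mkord.
apply: (ACd (size l) (fun i => (nth (0, 0) l i).1) (fun i => (nth (0, 0) l i).2)).
- move=> i; have [a b c _] := bnd i (ltn_ord i).
  by rewrite /= !in_itv/=; split; [|split]; lra.
- move=> i j _ _ ij; apply/val_inj; apply: (stacked_trivIset sl) => //.
- by rewrite -lte_fin; apply: le_lt_trans lU; exact: stacked_length sl.
Qed.
End AbsoluteContinuity.

(** * Periodic extension *)

Section Periodization.
Context {R : realType}.
Implicit Types (T u v : R) (g : R -> R) (k : int).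

Definition periodize T g u : R := g (u - (Num.floor (u / T))%:~R * T).

Lemma floor_period T u : 0 < T -> exists k, 0 <= u - k%:~R * T < T.
Proof.
move=> T0; exists (Num.floor (u / T)).
have := floor_itv (u / T); rewrite ler_pdivlMr// ltr_pdivrMr// intrD mulrDl mul1r.
by move=> ?; lra.
Qed.

Lemma periodizeE T g u k : 0 < T -> g 0 = g T -> 0 <= u - k%:~R * T <= T ->
  periodize T g u = g (u - k%:~R * T).
Proof.
move=> T0 gT /andP[k0 kT].
have floorE l : 0 <= u - l%:~R * T < T -> Num.floor (u / T) = l.
  move=> lT; apply: floor_def; rewrite ler_pdivlMr// ltr_pdivrMr// intrD mulrDl mul1r.
  by move: lT => ?; lra.
have [lt|ge] := ltP (u - k%:~R * T) T.
  by rewrite /periodize (floorE k)// k0.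
have uE : u - k%:~R * T = T by apply/le_anti; rewrite kT ge.
rewrite /periodize (floorE (k + 1)) intrD mulrDl mul1r opprD addrA uE subrr ?gT//.
by rewrite lexx.
Qed.

Lemma periodize_id T g u : 0 < T -> g 0 = g T -> 0 <= u <= T -> periodize T g u = g u.
Proof.
by move=> T0 gT uT; rewrite (@periodizeE _ _ _ 0)// mul0r subr0.
Qed.

Lemma periodizeD T g u : 0 < T -> g 0 = g T -> periodize T g (u + T) = periodize T g u.
Proof.
move=> T0 gT; have [k /andP[k0 /ltW kT]] := floor_period u T0.
rewrite (@periodizeE _ _ u k)//; last by rewrite k0.
have uE : u + T - (k + 1)%:~R * T = u - k%:~R * T by rewrite intrD; ring.
by rewrite (@periodizeE _ _ _ (k + 1))// uE // k0.
Qed.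

Lemma quotient_is_derive (f : R -> R) u l :
  (forall e, 0 < e -> exists2 d, 0 < d & forall s, s != u -> `|s - u| < d ->
     `|l - (s - u)^-1 * (f s - f u)| <= e) -> is_derive u 1 f l.
Proof.
move=> fd; suff cv : h^-1 *: ((f \o shift u) (h *: (1 : R)) - f u) @[h --> 0^'] --> l.
  by apply: DeriveDef; [apply/cvg_ex; exists l|exact/cvg_lim].
apply/cvgrPdist_le => e /fd[d d0 fde]; near=> h.
have h0 : h != 0 by near: h; exact: nbhs_dnbhs_neq.
have hd : `|h| < d by near: h; exact: dnbhs0_lt.
have := fde (h + u); rewrite addrK addrC -subr_eq0 addrAC subrr add0r => /(_ h0 hd).
by rewrite /= /GRing.scale /= mulr1 (addrC h).
Unshelve. all: by end_near. Qed.

(** The derivative of g along D, in epsilon-delta form. *)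
Definition quotient_limit (D : set R) g t l := forall e, 0 < e ->
  exists2 d, 0 < d & forall s, D s -> s != t -> `|s - t| < d ->
     `|l - (s - t)^-1 * (g s - g t)| <= e.

(** At a multiple of T, the derivative on the right is the one of g at 0 and the
derivative on the left is the one of g at T, and these agree. *)
Lemma is_derive_periodize T g dg : 0 < T -> g 0 = g T -> dg 0 = dg T ->
  (forall t, 0 <= t <= T -> quotient_limit `[0, T] g t (dg t)) ->
  forall u, is_derive u 1 (periodize T g) (periodize T dg u).
Proof.
move=> T0 gT dgT gd u; apply: quotient_is_derive => e e0.
(* near u, only the points of the same translate of [0, T] are considered *)
have near_piece k : 0 <= u - k%:~R * T <= T -> exists2 d, 0 < d &
    forall s, 0 <= s - k%:~R * T <= T -> s != u -> `|s - u| < d ->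
    `|periodize T dg u - (s - u)^-1 * (periodize T g s - periodize T g u)| <= e.
  move=> uk; have [d d0 gde] := gd _ uk _ e0; exists d => // s sk su sud.
  rewrite !(@periodizeE _ _ _ k)//.
  have sE : s - u = s - k%:~R * T - (u - k%:~R * T) by ring.
  rewrite sE; apply: gde; rewrite -?sE//.
  by rewrite -subr_eq0 -sE subr_eq0.
have [k /andP[k0 kT]] := floor_period u T0.
have [|d d0 right] := near_piece k; first by rewrite k0 ltW.
have [uk|uk] := eqVneq (u - k%:~R * T) 0; last first.
  have {}k0 : 0 < u - k%:~R * T by rewrite lt_neqAle eq_sym uk.
  exists (Num.min d (Num.min (u - k%:~R * T) (T - (u - k%:~R * T)))).
    by rewrite !lt_min d0 k0 subr_gt0.
  move=> s su; rewrite !lt_min => /and3P[sd].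
  by rewrite !ltr_norml => s1 s2; apply: right => //; lra.
have kE : (k - 1)%:~R * T = k%:~R * T - T by rewrite intrD; ring.
have [|d' d'0 left] := near_piece (k - 1); first by rewrite kE; lra.
exists (Num.min T (Num.min d d')); first by rewrite !lt_min T0 d0.
move=> s su; rewrite !lt_min => /and3P[]; rewrite ltr_norml => /andP[s1 s2] sd sd'.
have [us|us] := leP u s; first by apply: right => //; lra.
by apply: left => //; rewrite kE; lra.
Qed.

(** A step from u to v splits into the end of a period, whole periods, on which
g does not vary while a <= 0, and the beginning of a period. *)
Lemma periodize_slope_ge T g a : 0 < T -> g 0 = g T ->
  (forall u v, 0 <= u -> u <= v -> v <= T -> a * (v - u) <= g v - g u) ->
  forall u v, u <= v -> a * (v - u) <= periodize T g v - periodize T g u.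
Proof.
move=> T0 gT ga u v uv.
have aT : a * T <= 0 by have := ga 0 T (lexx 0) (ltW T0) (lexx T); rewrite gT subr0 subrr.
have [k /andP[k0 kT]] := floor_period u T0.
have [l /andP[l0 lT]] := floor_period v T0.
rewrite (@periodizeE _ _ u k)// ?k0 ?(ltW kT)// (@periodizeE _ _ v l)// ?l0 ?(ltW lT)//.
have [lk|kl] := leP l k.
  have lkE : l = k.
    apply/eqP; rewrite eq_le lk /= -ltzD1 -(ltr_int R) -(ltr_pM2r T0) intrD mulrDl mul1r.
    lra.
  subst l; have -> : v - u = (v - k%:~R * T) - (u - k%:~R * T) by ring.
  by apply: ga; lra.
have [j jE] : exists j : nat, l%:~R = k%:~R + 1 + j%:R :> R.
  exists `|(l - (k + 1))%R|%N; rewrite -[_%:R]/(_%:Z%:~R) gez0_abs ?subr_ge0 ?lezD1//.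
  by rewrite intrB intrD; ring.
have p1 : a * (T - (u - k%:~R * T)) <= g T - g (u - k%:~R * T) by apply: ga; lra.
have p2 : a * (v - l%:~R * T - 0) <= g (v - l%:~R * T) - g 0 by apply: ga; lra.
have p3 : j%:R * (a * T) <= 0 by rewrite mulr_ge0_le0.
have -> : a * (v - u) = a * (T - (u - k%:~R * T)) + a * (v - l%:~R * T - 0) + j%:R * (a * T).
  by rewrite jE; ring.
by rewrite gT in p2; lra.
Qed.

End Periodization.

(** * The sharp periodic inequality *)

Section FavardBohr.
Context {R : realType}.
Implicit Types s t u v c : R.

Lemma is_derive_shiftr (f : R -> R) (c u l : R) : is_derive (c + u) 1 f l ->
  is_derive u 1 (fun v => f (c + v)) l.
Proof.
move=> fd; have sd : is_derive u 1 (fun v : R => c + v) 1.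
  by rewrite -[X in is_derive _ _ _ X]add0r; apply: is_deriveD.
by rewrite -[l]mulr1; exact: (@is_derive1_comp _ f _ u l 1).
Qed.

Lemma is_derive_reflect (f : R -> R) (u l : R) : is_derive (- u) 1 f l ->
  is_derive u 1 (fun v => f (- v)) (- l).
Proof.
move=> fd; have sd : is_derive u 1 (fun v : R => - v) (- 1) by exact: is_deriveN.
by rewrite -mulrN1; exact: (@is_derive1_comp _ f _ u l (- 1)).
Qed.

Lemma antiderivative_exists (f : R -> R) (a b : R) : continuous f ->
  exists G : R -> R, forall u, a < u < b -> is_derive u 1 G (f u).
Proof.
move=> cf; exists (fun x => (\int[lebesgue_measure]_(t in `[a, x]) f t)%R).
move=> u /andP[au ub].
have fint : lebesgue_measure.-integrable `[a, b] (EFin \o f).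
  apply: continuous_compact_integrable; first exact: segment_compact.
  exact: continuous_subspaceT.
have [dG] := continuous_FTC1_closed ub fint au (cf u).
rewrite derive1E; exact: DeriveDef.
Qed.

(** The comparison applied to the odd part Z_0(u) = (Y_0(u) - Y_0(-u)) / 2, whose
derivatives are Z_i(u) = (Y_i(u) - (-1)^i Y_i(-u)) / 2.  As the order is even,
Z_(2k+1) adds the values of Y_(2k+1) at u and -u, so that its chords have
slopes that are half-differences of elements of [a, A]. *)
Lemma odd_part_bound (sigma : nat -> R) (h M a A : R) k (Y : nat -> R -> R) : 0 < h ->
  (forall j, \sum_(i < j.+1) (-1) ^+ i / (i.*2)`!%:R * sigma (j - i)%N = (j == 0%N)%:R) ->
  (forall i u, (i <= k.*2)%N -> - h <= u <= h -> is_derive u 1 (Y i) (Y i.+1 u)) ->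
  (forall j, (j <= k)%N -> Y j.*2 (- h) = Y j.*2 h) ->
  (forall u v, - h <= u -> u <= v -> v <= h ->
     a * (v - u) <= Y k.*2.+1 v - Y k.*2.+1 u <= A * (v - u)) ->
  M = (A - a) / 2 ->
  (forall u, 0 <= u <= h ->
    `|Y 0%N u - Y 0%N (- u)| / 2 <= M * ((h / 2) ^+ k.+1.*2 * sigma k.+1)) /\
  `|Y 1%N 0| <= M * ((h / 2) ^+ k.*2.+1 *
     \sum_(i < k.+1) (-1) ^+ i / (i.*2.+1)`!%:R * sigma (k - i)%N).
Proof.
move=> h0 sig Yd Yh Ys ME.
have M0 : 0 <= M.
  have := Ys 0 h; rewrite subr0 lexx oppr_le0 ltW// => /(_ isT isT isT)/andP[Y1 Y2].
  have := le_trans Y1 Y2; rewrite ler_pM2r// ME; lra.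
pose Z i u := (Y i u - (-1) ^+ i * Y i (- u)) / 2.
have [|||Zu Z0] := @lidstone_comparison R h M (lidstone_poly h sigma) h0 M0
  (lidstone_poly0 h sig) (deriv2_lidstone_poly h sigma) (lidstone_poly_bd h sig) k Z.
- move=> i u ik /andP[u0 uh].
  have Y1 : is_derive u 1 (Y i) (Y i.+1 u) by apply: Yd => //; lra.
  have Y2 : is_derive u 1 (fun v => Y i (- v)) (- Y i.+1 (- u)).
    by apply: is_derive_reflect; apply: Yd => //; lra.
  have -> : Z i = (1 / 2) \*: (Y i - ((-1) ^+ i) \*: (fun v => Y i (- v))).
    by apply/funext => v; rewrite /Z /GRing.scale /= mulrC mul1r.
  have Z1 := is_deriveZ (1 / 2) (is_deriveB Y1 (is_deriveZ ((-1) ^+ i) Y2)).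
  by apply: is_derive_eq Z1 _; rewrite /Z /GRing.scale /= exprS; field.
- move=> u v u0 uv vh; rewrite /Z exprS signr_double mulr1.
  have /andP[] : a * (v - u) <= Y k.*2.+1 v - Y k.*2.+1 u <= A * (v - u).
    by apply: Ys => //; lra.
  have /andP[] : a * (- u - - v) <= Y k.*2.+1 (- u) - Y k.*2.+1 (- v) <= A * (- u - - v).
    by apply: Ys; lra.
  have -> : - u - - v = v - u by ring.
  have -> : M * (v - u) = (A * (v - u) - a * (v - u)) / 2 by rewrite ME; ring.
  rewrite ler_norml; lra.
- move=> j jk; rewrite /Z signr_double !mul1r oppr0 Yh// !subrr.
  by rewrite mul0r.
split=> [u uh|].
  apply: (@le_trans _ _ `|Z 0%N u|).
    by rewrite /Z expr0 mul1r normrM (gtr0_norm (_ : 0 < 2^-1))// invr_gt0.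
  apply: le_trans (Zu u uh) _; rewrite ler_wpM2l//.
  by rewrite -(lidstone_poly_mid h sigma); exact: lidstone_poly_max.
have -> : Y 1%N 0 = Z 1%N 0 by rewrite /Z expr1 oppr0; field.
by rewrite -(deriv_lidstone_poly_left h sigma).
Qed.


End FavardBohr.

Section PeriodicInequality.
Context {R : realType}.
Implicit Types s t u v c : R.

Section PeriodicBound.
Variables (B E : nat -> R).
Hypotheses (hB : bernoulli_numbers B) (hE : euler_numbers E).
Variables (n : nat) (T a A : R) (X : nat -> R -> R).
Hypotheses (n_gt0 : (0 < n)%N) (T_gt0 : 0 < T).
Hypothesis Xd : forall i (u : R), (i.+1 < n)%N -> is_derive u 1 (X i) (X i.+1 u).
Hypothesis XT : forall i (u : R), (i < n)%N -> X i (u + T) = X i u.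
Hypothesis Xs : forall u v : R, u <= v ->
  a * (v - u) <= X n.-1 v - X n.-1 u <= A * (v - u).

Let sigma := secant_coef E.

Lemma slope_bounds_le : a <= A.
Proof.
have /andP[l r] := Xs (ltW T_gt0); have := le_trans l r.
by rewrite ler_pM2r// subr0.
Qed.

Lemma chain_continuous : continuous (X 0).
Proof.
have [n1 u|n1 u] := ltnP 1 n.
  have [d _] := Xd u n1; exact/differentiable_continuous/derivable1_diffP.
have nE : n.-1 = 0%N by case: n n_gt0 n1 => [|[]].
apply/cvgrPdist_le => e e0; near=> v.
have K0 : 0 < `|a| + `|A| + 1 by rewrite ltr_wpDl// addr_ge0.
have uv : `|u - v| <= e / (`|a| + `|A| + 1).
  by near: v; apply: (@cvgr_dist_le _ _ _ _ _ id) => //; rewrite divr_gt0.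
rewrite ler_pdivlMr// in uv.
have bound x y : x <= y -> `|X 0 y - X 0 x| <= (y - x) * (`|a| + `|A| + 1).
  move=> xy; have := Xs xy; rewrite nE => /andP[l r].
  have yx : 0 <= y - x by rewrite subr_ge0.
  have := ler_norm A; have := ler_norm (- a); rewrite normrN => ha hA.
  have hA' := ler_wpM2r yx hA; have ha' := ler_wpM2r yx ha.
  have := mulr_ge0 yx (normr_ge0 A); have := mulr_ge0 yx (normr_ge0 a).
  rewrite ler_norml; lra.
apply: le_trans _ uv; have [vu|/ltW uv'] := leP v u.
  by rewrite (ger0_norm (_ : 0 <= u - v)) ?subr_ge0//; exact: bound.
rewrite distrC [`|u - v|]distrC (ger0_norm (_ : 0 <= v - u)) ?subr_ge0//.
exact: bound.
Unshelve. all: by end_near. Qed.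

Let h := T / 2.
Let h_gt0 : 0 < h. Proof. by rewrite divr_gt0. Qed.
Let hT : T = h + h. Proof. by rewrite /h; field. Qed.

Lemma half_period i (c : R) : (i < n)%N -> X i (c - h) = X i (c + h).
Proof. by move=> lin; rewrite -XT//; congr (X _ _); rewrite /h; lra. Qed.

(** Odd part about the midpoint c of s and t, at distance |t - s| / 2 of c. *)
Lemma osc_bound_even k s t : n = k.+1.*2 -> 0 <= s <= T -> 0 <= t <= T ->
  X 0 t - X 0 s <= (A - a) * (T / 4) ^+ n * `|sigma k.+1|.
Proof.
move=> nE sT tT; pose c := (s + t) / 2.
have nE' : n.-1 = k.*2.+1 by rewrite nE.
have [||||YE _] := @odd_part_bound R sigma h ((A - a) / 2) a A k (fun i u => X i (c + u))
  h_gt0 (secant_coef_rec hE).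
- move=> i u ik _; apply: is_derive_shiftr; apply: Xd.
  by rewrite nE doubleS !ltnS.
- by move=> j jk; apply: half_period; rewrite nE ltn_double ltnS.
- move=> u v _ uv _; rewrite -nE'.
  have -> : v - u = c + v - (c + u) by ring.
  by apply: Xs; rewrite lerD2l.
- by [].
pose u := `|t - s| / 2.
have uh : 0 <= u <= h.
  by rewrite /u /h divr_ge0//= ler_pM2r ?invr_gt0// ler_norml; lra.
have := YE u uh; have -> : h / 2 = T / 4 by rewrite /h; field.
rewrite -nE -/sigma => YEu.
have : sigma k.+1 <= `|sigma k.+1| by exact: ler_norm.
have w0 : 0 <= (A - a) * (T / 4) ^+ n.
  by rewrite mulr_ge0 ?subr_ge0 ?slope_bounds_le// exprn_ge0// divr_ge0// ltW.
move=> /(ler_wpM2l w0); apply: le_trans.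
have -> : (A - a) * (T / 4) ^+ n * sigma k.+1 =
  (A - a) / 2 * ((T / 4) ^+ n * sigma k.+1) * 2 by field.
rewrite -ler_pdivrMr//; apply: le_trans YEu.
rewrite ler_pM2r ?invr_gt0// /u /c.
have [st|/ltW ts] := leP s t.
  rewrite (ger0_norm (_ : 0 <= t - s)) ?subr_ge0//.
  have -> : (s + t) / 2 + (t - s) / 2 = t by field.
  have -> : (s + t) / 2 - (t - s) / 2 = s by field.
  exact: ler_norm.
rewrite (ler0_norm (_ : t - s <= 0)) ?subr_le0//.
have -> : (s + t) / 2 + - (t - s) / 2 = s by field.
have -> : (s + t) / 2 - - (t - s) / 2 = t by field.
by rewrite distrC; exact: ler_norm.
Qed.

(** A primitive G of X raises the order to the even number n + 1.  The
difference (G(t+u) - G(s+u)) / 2 is periodic, although G need not be, and its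
top chords have slopes in [(a - A) / 2, (A - a) / 2]; the value of its
derivative at 0 is half the oscillation. *)
Lemma osc_bound_odd k s t : n = k.*2.+1 -> 0 <= s <= T -> 0 <= t <= T ->
  X 0 t - X 0 s <= (A - a) * (T / 4) ^+ n *
    (`|(4 ^+ k.+1.*2 - 2 ^+ k.+1.*2) * B k.+1.*2| / (k.+1.*2)`!%:R).
Proof.
move=> nE sT tT; have h0 := h_gt0; have hTE := hT.
have [G Gd] := antiderivative_exists (- T) (2 * T) chain_continuous.
pose Y i u := if i is j.+1 then (X j (t + u) - X j (s + u)) / 2
              else (G (t + u) - G (s + u)) / 2.
have nE' : n.-1 = k.*2 by rewrite nE.
have halfd (f g : R -> R) u df dg : is_derive (t + u) 1 f df -> is_derive (s + u) 1 g dg ->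
    is_derive u 1 (fun v => (f (t + v) - g (s + v)) / 2) ((df - dg) / 2).
  move=> /is_derive_shiftr fd /is_derive_shiftr gd.
  have -> : (fun v => (f (t + v) - g (s + v)) / 2) =
            (1 / 2) \*: ((fun v => f (t + v)) - (fun v => g (s + v))).
    by apply/funext => v; rewrite /GRing.scale /= mulrC mul1r.
  have d := is_deriveZ (1 / 2) (is_deriveB fd gd).
  by apply: is_derive_eq d _; rewrite /GRing.scale /= mulrC mul1r.
have [||||_] := @odd_part_bound R sigma h ((A - a) / 2) ((a - A) / 2) ((A - a) / 2) k Y
  h_gt0 (secant_coef_rec hE).
- move=> [|i] u ik /andP[u1 u2]; apply: halfd.
  + by apply: Gd; rewrite hTE in tT *; lra.
  + by apply: Gd; rewrite hTE in sT *; lra.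
  + by apply: Xd; rewrite nE ltnS.
  + by apply: Xd; rewrite nE ltnS.
- move=> [|j] jk /=; last first.
    have jn : (j.*2.+1 < n)%N by rewrite nE ltnS ltn_double.
    by rewrite !half_period.
  (* the increment of G over a full period does not depend on its origin *)
  pose D u := G (h + u) - G (- h + u).
  have Dd u : 0 <= u <= T -> is_derive u 1 D 0.
    move=> uT; have G1 : is_derive u 1 (fun v => G (h + v)) (X 0 (h + u)).
      by apply: is_derive_shiftr; apply: Gd; rewrite hTE in uT *; lra.
    have G2 : is_derive u 1 (fun v => G (- h + v)) (X 0 (- h + u)).
      by apply: is_derive_shiftr; apply: Gd; rewrite hTE in uT *; lra.
    have -> : 0 = X 0 (h + u) - X 0 (- h + u) :> R.
      by rewrite [h + u]addrC [- h + u]addrC half_period// subrr.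
    exact: is_deriveB.
  have Dle u v : 0 <= u -> u < v -> v <= T -> D v = D u.
    move=> u0 uv vT; have [w uvw|c _] := @MVT_itv _ D (cst 0) u v uv.
      by apply: Dd; lra.
    by rewrite mul0r => /eqP; rewrite subr_eq0 => /eqP.
  have Dst : D t = D s.
    have [lt|lt|->//] := ltgtP s t; first by apply: Dle; lra.
    by apply/esym; apply: Dle; lra.
  by move: Dst; rewrite /D [h + t]addrC [h + s]addrC [- h + t]addrC [- h + s]addrC; lra.
- move=> u v _ uv _; rewrite /= -nE'.
  have := Xs (_ : t + u <= t + v); rewrite lerD2l => /(_ uv)/andP[].
  have := Xs (_ : s + u <= s + v); rewrite lerD2l => /(_ uv)/andP[].
  have -> : t + v - (t + u) = v - u by ring.
  have -> : s + v - (s + u) = v - u by ring.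
  have -> : (a - A) / 2 * (v - u) = (a * (v - u) - A * (v - u)) / 2 by ring.
  have -> : (A - a) / 2 * (v - u) = (A * (v - u) - a * (v - u)) / 2 by ring.
  lra.
- by field.
rewrite /Y /= !addr0 (bernoulli_secant hB hE).
have -> : h / 2 = T / 4 by rewrite /h; field.
rewrite -nE.
pose b := (-1) ^+ k * (4 ^+ k.+1.*2 - 2 ^+ k.+1.*2) * B k.+1.*2 / (k.+1.*2)`!%:R.
rewrite -/b => Yle.
have -> : `|(4 ^+ k.+1.*2 - 2 ^+ k.+1.*2) * B k.+1.*2| / (k.+1.*2)`!%:R = `|b|.
  by rewrite /b -mulrA -mulrA [in RHS]normrM normrX normrN1 expr1n mul1r mulrA
    [in RHS]normrM normfV normr_nat.
have w0 : 0 <= (A - a) * (T / 4) ^+ n.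
  by rewrite mulr_ge0 ?subr_ge0 ?slope_bounds_le// exprn_ge0// divr_ge0// ltW.
have := ler_wpM2l w0 (ler_norm b); have := le_trans (ler_norm _) Yle.
have -> : (A - a) / 2 * ((T / 4) ^+ n * b) = (A - a) * (T / 4) ^+ n * b / 2 by ring.
lra.
Qed.

(** The constants agree: 4^n K_n is the coefficient of z^n in sec z + tan z. *)
Lemma osc_bound s t : 0 <= s <= T -> 0 <= t <= T ->
  X 0 t - X 0 s <= (A - a) * T ^+ n * Kconst B E n.
Proof.
move=> sT tT; rewrite /Kconst; case: ifPn => [no|ne].
  have nE : n = n./2.*2.+1 by rewrite -[LHS]odd_double_half no.
  apply: le_trans (osc_bound_odd nE sT tT) _.
  have -> : n./2.+1.*2 = n.+1 by rewrite doubleS [in RHS]nE.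
  pose q : R := 2 ^+ n; have q1 : 1 <= q by rewrite exprn_ege1// ler1n.
  have q4 : 4 ^+ n = q * q :> R by rewrite -exprMn -natrM.
  have qp : 2 ^+ n.-1 = q / 2 :> R.
    by rewrite /q -(prednK n_gt0) exprS [_ / _]mulrAC divff ?mul1r ?pnatr_eq0.
  have e4 : 4 ^+ n.+1 - 2 ^+ n.+1 = 2 * q * (2 * q - 1) by rewrite !exprS q4 -/q; ring.
  rewrite e4 qp exprS -/q normrM ger0_norm; last by rewrite mulr_ge0//; lra.
  rewrite expr_div_n q4 le_eqVlt; apply/orP; left; apply/eqP; field.
  by rewrite factr_neq0/= gt_eqF//; lra.
have nE : n = n./2.*2 by rewrite -[LHS]odd_double_half (negPf ne).
have n2 : (0 < n./2)%N by rewrite -double_gt0 -nE.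
have nE' : n = n./2.-1.+1.*2 by rewrite prednK.
apply: le_trans (osc_bound_even nE' sT tT) _.
have sE : `|sigma n./2| = `|E n| / n`!%:R.
  by rewrite /sigma /secant_coef -nE !normrM normrX normrN1 expr1n mul1r normfV normr_nat.
rewrite prednK// sE expr_div_n.
rewrite le_eqVlt; apply/orP; left; apply/eqP; field.
by rewrite factr_neq0 expf_neq0// pnatr_eq0.
Qed.

End PeriodicBound.
End PeriodicInequality.

(** * Components of a solution *)

Section Components.
Context {R : realType}.
Implicit Types (T a A L s t u v : R) (f : R -> R).

Lemma ae_leb_sub T (P Q : R -> Prop) : (forall t, P t -> Q t) ->
  (\forall t \ae leb T, P t) -> \forall t \ae leb T, Q t.
Proof.
move=> PQ [N [mN N0 NP]]; exists N; split=> // t Qt; apply: NP.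
by apply: contra_not Qt; exact: PQ.
Qed.

Lemma ae_leb_and T (P Q : R -> Prop) : (\forall t \ae leb T, P t) ->
  (\forall t \ae leb T, Q t) -> \forall t \ae leb T, P t /\ Q t.
Proof.
have F : Filter (almost_everywhere (leb T)) by exact: ae_filter_ringOfSetsType.
exact: (@filterI _ _ F).
Qed.

Lemma AC_linear_combination (D : set R) f (r c : R) :
  absolutely_continuous_in D f -> absolutely_continuous_in D (fun u => r * f u + c * u).
Proof.
move=> ACf e e0; have r0 : 0 < `|r| + 1 by rewrite ltr_wpDl.
have c0 : 0 < `|c| + 1 by rewrite ltr_wpDl.
have [|d d0 ACd] := ACf (e / 2 / (`|r| + 1)); first by rewrite !divr_gt0.
exists (Num.min d (e / 2 / (`|c| + 1))); first by rewrite lt_min d0 !divr_gt0.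
move=> k p q Dpq tpq; rewrite lt_min => /andP[/(ACd k p q Dpq tpq) fs cs].
apply: (@le_lt_trans _ _ (\sum_(i < k) ((`|r| + 1) * `|f (q i) - f (p i)| +
   (`|c| + 1) * (q i - p i)))).
  apply: ler_sum => i _; have [_ [_ pq]] := Dpq i.
  have -> : r * f (q i) + c * q i - (r * f (p i) + c * p i) =
    r * (f (q i) - f (p i)) + c * (q i - p i) by ring.
  apply: le_trans (ler_normD _ _) _; rewrite !normrM.
  rewrite (ger0_norm (_ : 0 <= q i - p i)) ?subr_ge0//.
  by apply: lerD; rewrite ler_wpM2r ?subr_ge0// lerDl.
rewrite big_split /= -!mulr_sumr [ltRHS]splitr; apply: ltrD.
  by rewrite mulrC -ltr_pdivlMr.
by rewrite mulrC -ltr_pdivlMr.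
Qed.

Definition quotient_cvg (D : set R) f (t l : R) : Prop :=
  (s - t)^-1 * (f s - f t) @[s --> within D t^'] --> l.

(** f - a id is nondecreasing. *)
Lemma AC_slope_ge T f a : absolutely_continuous_in `[0, T] f ->
  (\forall t \ae leb T, t \in `[0, T] ->
     exists2 l, a <= l & quotient_cvg `[0, T] f t l) ->
  forall u v, 0 <= u -> u <= v -> v <= T -> a * (v - u) <= f v - f u.
Proof.
move=> ACf fd u v u0 uv vT.
have := @AC_nondecreasing R T (fun u => 1 * f u + - a * u)
  (AC_linear_combination 1 (- a) ACf) _ u v u0 uv vT.
rewrite !mul1r => H; suff : f u + - a * u <= f v + - a * v by lra.
apply: H; apply: ae_leb_sub fd => t ft tT e e0.
have [l al /cvgrPdist_le/(_ e e0)] := ft tT; rewrite !near_withinE.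
apply: filterS2 (nbhs_dnbhs_neq t) => s st h Ds; have := h Ds.
have -> : (s - t)^-1 * (1 * f s + - a * s - (1 * f t + - a * t)) =
   (s - t)^-1 * (f s - f t) - a by field; rewrite subr_eq0.
by rewrite ler_norml => /andP[_]; lra.
Qed.

Lemma AC_slope_le T f A : absolutely_continuous_in `[0, T] f ->
  (\forall t \ae leb T, t \in `[0, T] ->
     exists2 l, l <= A & quotient_cvg `[0, T] f t l) ->
  forall u v, 0 <= u -> u <= v -> v <= T -> f v - f u <= A * (v - u).
Proof.
move=> ACf fd u v u0 uv vT.
have ACN : absolutely_continuous_in `[0, T] (fun u => - f u).
  have := AC_linear_combination (-1) 0 ACf.
  by under [X in absolutely_continuous_in _ X]eq_fun do rewrite mul0r addr0 mulN1r.
have := @AC_slope_ge T (fun u => - f u) (- A) ACN _ u v u0 uv vT.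
rewrite mulNr => H; suff : - (A * (v - u)) <= - f v - - f u by lra.
apply: H; apply: ae_leb_sub fd => t ft tT; have [l lA fl] := ft tT.
exists (- l); first by rewrite lerN2.
rewrite /quotient_cvg; under eq_fun do rewrite -opprD mulrN.
exact: cvgN.
Qed.

Lemma AC_continuous (V : normedModType R) T (f : R -> V) :
  absolutely_continuous_in `[0, T] f -> {within `[0, T], continuous f}.
Proof.
move=> ACf; apply/subspace_continuousP => t tT; apply/cvgrPdist_lt => e e0.
have [d d0 ACd] := ACf e e0; rewrite near_withinE; exists d => //= s st sT.
have bound p q : p <= q -> p \in `[0, T] -> q \in `[0, T] -> q - p < d -> `|f q - f p| < e.
  move=> pq pT qT qpd; have := ACd 1%N (fun=> p) (fun=> q); rewrite !big_ord1; apply=> //.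
  by move=> i j _ _ _; rewrite (ord1 i) (ord1 j).
move: st; rewrite /ball_ /= ltr_norml => /andP[st1 st2].
have [le_st|/ltW le_ts] := leP s t; first by apply: bound => //; lra.
by rewrite distrC; apply: bound => //; lra.
Qed.

Lemma quotient_cvg_limit (D : set R) f t l :
  quotient_cvg D f t l -> quotient_limit D f t l.
Proof.
move=> /cvgrPdist_le fl e /fl; rewrite near_withinE => -[d /= d0 fd].
by exists d => // s Ds st sd; apply: fd => //=; rewrite distrC.
Qed.

Lemma derive_in_coord m (D : set R) (f : R -> 'rV[R]_m) j t :
  derivable_in D f t -> quotient_cvg D (fun s => f s ord0 j) t (derive_in D f t ord0 j).
Proof.
move=> df; have cj := @coord_continuous R 1 m ord0 j (derive_in D f t).
rewrite /quotient_cvg.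
have -> : (fun s => (s - t)^-1 * (f s ord0 j - f t ord0 j)) =
    (fun M : 'rV[R]_m => M ord0 j) \o diff_quot f t.
  by apply/funext => s; rewrite /diff_quot /= !mxE.
exact: cvg_comp df cj.
Qed.

Lemma normr_coord m (v : 'rV[R]_m) j : `|v ord0 j| <= `|v|.
Proof.
change (`|v ord0 j| <= mx_norm v); rewrite mx_normrE.
exact: (le_bigmax 0 (fun ij : 'I_1 * 'I_m => `|v ij.1 ij.2|) (ord0, j)).
Qed.

Lemma AC_coord m (D : set R) (f : R -> 'rV[R]_m) j :
  absolutely_continuous_in D f -> absolutely_continuous_in D (fun s => f s ord0 j).
Proof.
move=> ACf e /ACf[d d0 ACd]; exists d => // k p q Dpq tpq spq.
apply: le_lt_trans (ACd k p q Dpq tpq spq); apply: ler_sum => i _.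
by have := normr_coord (f (q i) - f (p i)) j; rewrite !mxE.
Qed.

(** Each component is a scalar chain on [0, T] that extends periodically, with top
slopes in [a, A]. *)
Lemma component_bound (B E : nat -> R) (hB : bernoulli_numbers B) (hE : euler_numbers E)
    n m T (F : (R -> 'rV[R]_m) -> (R -> 'rV[R]_m)) x j a A :
  (0 < n)%N -> 0 < T -> periodic_solution n T F x ->
  (\forall t \ae leb T, a <= F x t ord0 j <= A) ->
  forall s t, 0 <= s <= T -> 0 <= t <= T ->
  x t ord0 j - x s ord0 j <= (A - a) * T ^+ n * Kconst B E n.
Proof.
move=> n0 T0 [[dx ACx] aex perx] aeF s t sT tT.
pose g i u := deriven_in `[0, T] i x u ord0 j.
have gT i : (i < n)%N -> g i 0 = g i T by move=> /perx; rewrite /g => ->.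
have gd i u : (i.+1 < n)%N -> 0 <= u <= T -> quotient_limit `[0, T] (g i) u (g i.+1 u).
  move=> lin uT; apply: quotient_cvg_limit; apply: derive_in_coord.
  by apply: dx => //; rewrite -ltnS prednK.
have gAC : absolutely_continuous_in `[0, T] (g n.-1) by exact/AC_coord/ACx.
have gtop : \forall u \ae leb T, exists2 l, a <= l <= A & quotient_cvg `[0, T] (g n.-1) u l.
  apply: ae_leb_sub (ae_leb_and aex aeF) => u [[du Eu] Fu].
  exists (F x u ord0 j) => //.
  have -> : F x u ord0 j = derive_in `[0, T] (deriven_in `[0, T] n.-1 x) u ord0 j.
    by rewrite -Eu -{1}(prednK n0).
  exact: derive_in_coord.
have slo u v : 0 <= u -> u <= v -> v <= T -> a * (v - u) <= g n.-1 v - g n.-1 u.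
  apply: AC_slope_ge => //; apply: ae_leb_sub gtop => w [l /andP[al _] gl] _.
  by exists l.
have shi u v : 0 <= u -> u <= v -> v <= T -> g n.-1 v - g n.-1 u <= A * (v - u).
  apply: AC_slope_le => //; apply: ae_leb_sub gtop => w [l /andP[_ lA] gl] _.
  by exists l.
pose X i := periodize T (g i).
have Xd i (u : R) : (i.+1 < n)%N -> is_derive u 1 (X i) (X i.+1 u).
  move=> lin; apply: (is_derive_periodize T0 (gT i (ltnW lin)) (gT _ lin)).
  exact: (fun w => gd i w lin).
have XT i (u : R) : (i < n)%N -> X i (u + T) = X i u.
  by move=> lin; apply: periodizeD => //; exact: gT.
have n1 : (n.-1 < n)%N by rewrite prednK.
have Xs (u v : R) : u <= v -> a * (v - u) <= X n.-1 v - X n.-1 u <= A * (v - u).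
  move=> uv; rewrite periodize_slope_ge ?gT//=.
  have := @periodize_slope_ge R T (fun w => - g n.-1 w) (- A) T0 _ _ u v uv.
  rewrite (gT _ n1) => /(_ erefl) H.
  suff : - A * (v - u) <= - X n.-1 v - - X n.-1 u by lra.
  apply: H => w z w0 wz zT; have := shi w z w0 wz zT; lra.
have := @osc_bound R B E hB hE n T a A X n0 T0 Xd XT Xs s t sT tT.
by rewrite /X !periodize_id// ?gT.
Qed.

Lemma ess_bounds_real T (f : R -> R) : 0 < T ->
  (ess_sup (leb T) (fun t => `|f t|%:E) < +oo)%E ->
  exists a A, [/\ ess_inf (leb T) (fun t => (f t)%:E) = a%:E,
    ess_sup (leb T) (fun t => (f t)%:E) = A%:E &
    \forall t \ae leb T, a <= f t <= A].
Proof.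
move=> T0 /ess_supr_bounded[C fC].
have muT : (0 < leb T setT)%E.
  have -> : leb T setT = lebesgue_measure (setT `&` `[0, T] : set R) by [].
  by rewrite setTI lebesgue_measure_itv /= lte_fin T0 -EFinD subr0 lte_fin.
have hi : (ess_sup (leb T) (fun t => (f t)%:E) <= C%:E)%E.
  apply/ess_supP; apply: ae_leb_sub fC => t /(le_trans (ler_norm _)).
  by rewrite lee_fin.
have lo : ((- C)%:E <= ess_inf (leb T) (fun t => (f t)%:E))%E.
  apply/ess_infP; apply: ae_leb_sub fC => t; rewrite lee_fin ler_norml.
  by case/andP.
have le : (ess_inf (leb T) (fun t => (f t)%:E) <= ess_sup (leb T) (fun t => (f t)%:E))%E.
  apply: (@ess_sup_gee _ _ _ (leb T)) => //.
  exact: (@ess_inf_le _ _ _ (leb T) (fun t => (f t)%:E)).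
have supE : (ess_sup (leb T) (fun t => (f t)%:E)) \is a fin_num.
  rewrite fin_numElt (lt_le_trans (ltNyr (- C)) (le_trans lo le))/=.
  exact: le_lt_trans hi (ltry _).
have infE : (ess_inf (leb T) (fun t => (f t)%:E)) \is a fin_num.
  rewrite fin_numElt (lt_le_trans (ltNyr (- C)) lo)/=.
  exact: le_lt_trans (le_trans le hi) (ltry _).
exists (fine (ess_inf (leb T) (fun t => (f t)%:E))),
  (fine (ess_sup (leb T) (fun t => (f t)%:E))); split; rewrite ?fineK//.
have := ae_leb_and (ess_inf_le (leb T) (fun t => (f t)%:E))
                   (ess_sup_ge (leb T) (fun t => (f t)%:E)).
by apply: ae_leb_sub => t; rewrite -!lee_fin !fineK// => -[-> ->].
Qed.

(** Compactness turns the supremum and the infimum into values. *)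
Lemma osc_attained T f : 0 < T -> {within `[0, T], continuous f} ->
  exists s t, [/\ 0 <= s <= T, 0 <= t <= T,
    (forall u, 0 <= u <= T -> f s <= f u <= f t) &
    sup [set f u | u in `[0, T]] - inf [set f u | u in `[0, T]] = f t - f s].
Proof.
move=> T0 cf; have [t tT ft] := EVT_max (ltW T0) cf.
have [s sT fs] := EVT_min (ltW T0) cf.
exists s, t; split; [by rewrite in_itv in sT|by rewrite in_itv in tT| |].
  by move=> u uT; rewrite fs ?ft// in_itv.
have ne : [set f u | u in `[0, T]] !=set0 by exists (f t), t.
congr (_ - _); apply/le_anti/andP; split.
- by apply: ge_sup => // _ [u uT <-]; exact: ft.
- apply: ub_le_sup; last by exists t.
  by exists (f t) => _ [u uT <-]; exact: ft.
- apply: ge_inf; last by exists s.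
  by exists (f s) => _ [u uT <-]; exact: fs.
- by apply: lb_le_inf => // _ [u uT <-]; exact: fs.
Qed.

Lemma Kconst_ge0 (B E : nat -> R) n : 0 <= Kconst B E n.
Proof.
rewrite /Kconst; case: ifP => _; apply: divr_ge0; rewrite ?mulr_ge0 ?exprn_ge0//.
by rewrite subr_ge0 exprn_ege1// ler1n.
Qed.

Lemma powR_inv_le (K T : R) n : (0 < n)%N -> 0 < T -> 0 <= K -> 1 <= K * T ^+ n ->
  1 / K `^ (1 / n%:R) <= T.
Proof.
move=> n0 T0 K0 KT; have {}K0 : 0 < K.
  rewrite lt_neqAle K0 andbT; apply/eqP => KE.
  by move: KT; rewrite -KE mul0r ler10.
have p0 : 0 < K `^ (1 / n%:R) by exact: powR_gt0.
have n0' : n%:R != 0 :> R by rewrite pnatr_eq0 -lt0n.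
rewrite ler_pdivrMr// mulrC -(@expr_ge1 _ n)// ?mulr_ge0 ?(ltW p0) ?(ltW T0)//.
by rewrite exprMn -powR_mulrn ?(ltW p0)// -powRrM divfK// powRr1// ltW.
Qed.

End Components.

Theorem theorem1 (R : realType) (B E : nat -> R)
    (hB : bernoulli_numbers B) (hE : euler_numbers E)
    (n m : nat) (hn : (1 <= n)%N) (hm : (1 <= m)%N)
    (T L : R) (hT : 0 < T) (hL : 0 < L)
    (F : (R -> 'rV[R]_m) -> (R -> 'rV[R]_m))
    (hF : is_operator T F)
    (hFL : forall x, C_space T x ->
       (max_ess_osc T (F x) <= L%:E * max_osc T x)%E)
    (hsol : exists x : R -> 'rV[R]_m, periodic_solution n T F x /\
       ~ (exists c : 'rV[R]_m, forall t, t \in `[0, T] -> x t = c)) :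
  1 / (L * Kconst B E n) `^ (1 / n%:R) <= T.
Proof.
have [x [solx ncx]] := hsol.
have Cx : C_space T x by case: solx => -[_ /(_ 0%N (leq0n _))/AC_continuous].
have cxj j : {within `[0, T], continuous (fun u => x u ord0 j)}.
  by case: solx => -[_ /(_ 0%N (leq0n _))/(AC_coord j)/AC_continuous].
pose osc i := sup [set x u ord0 i | u in `[0, T]] - inf [set x u ord0 i | u in `[0, T]].
(* the oscillation of this component bounds the essential oscillations of all (Fx)_i *)
pose j := [arg max_(i > Ordinal hm) osc i]%O.
have oscj i : osc i <= osc j.
  by rewrite /j; case: Order.TotalTheory.arg_maxP => // k _; apply.
have [s [t [sT tT xst oscE]]] := osc_attained hT (cxj j).
(* if all oscillations vanish, the solution is constant *)
have osc_gt0 : 0 < osc j.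
  rewrite ltNge; apply/negP => oscj0; apply: ncx; exists (x 0) => u uT.
  apply/rowP => i; have [s' [t' [_ _ xi oscEi]]] := osc_attained hT (cxj i).
  have := le_trans (oscj i) oscj0; rewrite /osc oscEi.
  have z0 : (0 : R) <= 0 <= T by apply/andP; split=> //; exact: ltW.
  have u0 : 0 <= u <= T by rewrite in_itv in uT.
  have /andP[] := xi 0 z0; have /andP[] := xi u u0.
  by move=> *; apply/le_anti; lra.
have [FC _] := hF; have [_ bndF] := FC x Cx j.
have [a [A [aE AE aeF]]] := ess_bounds_real hT bndF.
have gap_le : A - a <= L * osc j.
  rewrite -lee_fin EFinB -AE -aE EFinM.
  apply: (@le_trans _ _ (max_ess_osc T (F x))).
    exact: (le_bigmax _ (fun i => ess_sup (leb T) (fun t => (F x t ord0 i)%:E) -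
                           ess_inf (leb T) (fun t => (F x t ord0 i)%:E))%E j).
  apply: le_trans (hFL x Cx) _; rewrite lee_pmul2l//.
  by apply/bigmax_leP; split; [exact: leNye|move=> i _; rewrite lee_fin; exact: oscj].
apply: powR_inv_le => //; first by rewrite mulr_ge0 ?Kconst_ge0// ltW.
have TK : 0 <= T ^+ n * Kconst B E n by rewrite mulr_ge0 ?Kconst_ge0// exprn_ge0// ltW.
have := component_bound hB hE hn hT solx aeF sT tT.
rewrite -oscE -/(osc j) -mulrA => /le_trans/(_ (ler_wpM2r TK gap_le)).
have -> : L * osc j * (T ^+ n * Kconst B E n) = osc j * (L * Kconst B E n * T ^+ n) by ring.
by rewrite -{1}[osc j]mulr1 ler_pM2l.
Qed.
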